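(* Let $n\ge 1$ be an integer. The maximum of the $(2n-1)$-th normalized Steklov eigenvalue $\tilde\sigma_{2n-1}(g)$ among all rotationally symmetric metrics $g=f(t)^2(dt^2+d\theta^2)$ on cylinders $[0,T]\times\mathbb{S}^1$ (all $T>0$) is achieved by the critical $n$-catenoid immersed in $\mathbb{R}^3$.
   Context: $\mathbb{S}^1=\mathbb{R}/2\pi\mathbb{Z}$; $f>0$ is smooth on $[0,T]$. For a compact Riemannian surface $(M,g)$ with nonempty boundary, the Dirichlet-to-Neumann map sends $u\in C^\infty(\partial M)$ to $\partial\hat u/\partial n$, with $\hat u$ the harmonic extension and $n$ the unit outward normal; its eigenvalues $0=\sigma_0(g)<\sigma_1(g)\le\sigma_2(g)\le\cdots$ (with multiplicity) are the Steklov eigenvalues, and $\tilde\sigma_k(g)=\sigma_k(g)L_g(\partial M)$, where $L_g(\partial M)$ is the length of $\partial M$. Let $T_{2,0}(1)$ be the unique positive root of $s=\coth s$. The $n$-catenoid is the immersed minimal surface in $\mathbb{R}^3$ parameterized by $(t,\theta)\mapsto(nt,\ \cosh(nt)\cos(n\theta),\ \cosh(nt)\sin(n\theta))$, and the critical $n$-catenoid is the portion with $t\in[-T_{2,0}(1)/n,\ T_{2,0}(1)/n]$, $\theta\in\mathbb{S}^1$. ''Achieved by'' this immersed surface means: the cylinder $[-T_{2,0}(1)/n,T_{2,0}(1)/n]\times\mathbb{S}^1$ (identified with $[0,2T_{2,0}(1)/n]\times\mathbb{S}^1$ by translation in $t$), with the metric induced by the parameterization from the Euclidean metric, attains the maximum.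 *)

(* Defs.v *)
From Stdlib Require Import Reals List ClassicalEpsilon.
From Coquelicot Require Import Coquelicot.
Open Scope R_scope.

Definition smooth (h : R -> R) : Prop := forall k x, ex_derive_n h k x.

Definition smooth_on (a b : R) (h : R -> R) : Prop :=
  exists h0, smooth h0 /\ forall x, a <= x <= b -> h x = h0 x.

(* Functions on S^1 = R / 2 pi Z are 2 pi-periodic functions on R. *)
Definition smooth_circle (h : R -> R) : Prop :=
  smooth h /\ forall x, h (x + 2 * PI) = h x.

(* An element of C^oo([0,T] x S^1), smooth up to the boundary, is the
   restriction of an element of C^oo(R x S^1); we carry such an extension.
   All uses below depend only on its values on [0,T] x S^1. *)
Definition smooth_cylinder (u : R -> R -> R) : Prop :=
  (forall k t x, ex_diff_n u k t x) /\ forall t x, u t (x + 2 * PI) = u t x.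

Definition d_t (u : R -> R -> R) (t x : R) : R := Derive (fun s => u s x) t.
Definition d_th (u : R -> R -> R) (t x : R) : R := Derive (fun y => u t y) x.

(* g = g_tt dt^2 + 2 g_th dt dtheta + g_hh dtheta^2.  Only the values at
   points with 0 <= t <= T are meaningful. *)
Record metric := Metric {
  g_tt : R -> R -> R;
  g_th : R -> R -> R;
  g_hh : R -> R -> R }.

Definition det_g (g : metric) (t x : R) : R :=
  g_tt g t x * g_hh g t x - g_th g t x ^ 2.

(* The inverse metric g^{ij}. *)
Definition ginv_tt (g : metric) (t x : R) : R := g_hh g t x / det_g g t x.
Definition ginv_th (g : metric) (t x : R) : R := - g_th g t x / det_g g t x.
Definition ginv_hh (g : metric) (t x : R) : R := g_tt g t x / det_g g t x.

(* The components g^{ij} d_j u of the gradient. *)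
Definition grad_t (g : metric) (u : R -> R -> R) (t x : R) : R :=
  ginv_tt g t x * d_t u t x + ginv_th g t x * d_th u t x.
Definition grad_th (g : metric) (u : R -> R -> R) (t x : R) : R :=
  ginv_th g t x * d_t u t x + ginv_hh g t x * d_th u t x.

(* |g|^(-1/2) d_i (|g|^(1/2) g^{ij} d_j u) *)
Definition laplacian (g : metric) (u : R -> R -> R) (t x : R) : R :=
  / sqrt (det_g g t x) *
  (d_t (fun s y => sqrt (det_g g s y) * grad_t g u s y) t x +
   d_th (fun s y => sqrt (det_g g s y) * grad_th g u s y) t x).

(* Imposed at interior points only, so that no value of g outside the
   cylinder enters. *)
Definition harmonic (T : R) (g : metric) (u : R -> R -> R) : Prop :=
  forall t x, 0 < t < T -> laplacian g u t x = 0.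

Inductive bd_component := Bottom | Top.

Definition bd_pos (T : R) (e : bd_component) : R :=
  match e with Bottom => 0 | Top => T end.

Definition bd_sign (e : bd_component) : R :=
  match e with Bottom => -1 | Top => 1 end.

Definition bd_fun := bd_component -> R -> R.

Definition smooth_bd (phi : bd_fun) : Prop := forall e, smooth_circle (phi e).

(* du(n), where n = +/- grad t / |grad t| is the outward unit normal and
   |grad t| = (g^{tt})^(1/2); note that <grad t, grad u> = grad_t g u. *)
Definition normal_derivative (T : R) (g : metric) (u : R -> R -> R) : bd_fun :=
  fun e x => bd_sign e * grad_t g u (bd_pos T e) x / sqrt (ginv_tt g (bd_pos T e) x).

Definition boundary_length (T : R) (g : metric) : R :=
  RInt (fun x => sqrt (g_hh g 0 x)) 0 (2 * PI) +
  RInt (fun x => sqrt (g_hh g T x)) 0 (2 * PI).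

(* The graph of the Dirichlet-to-Neumann map: phi is sent to psi. *)
Definition DN_map (T : R) (g : metric) (phi psi : bd_fun) : Prop :=
  exists u, smooth_cylinder u /\ harmonic T g u /\
    (forall e x, u (bd_pos T e) x = phi e x) /\
    (forall e x, normal_derivative T g u e x = psi e x).

Definition steklov_eigenspace (T : R) (g : metric) (s : R) (phi : bd_fun) : Prop :=
  smooth_bd phi /\ DN_map T g phi (fun e x => s * phi e x).

Definition lin_comb (d : nat) (c : nat -> R) (b : nat -> bd_fun) : bd_fun :=
  fun e x => sum_n_m (fun i => c i * b i e x) 1 d.

(* b 1, ..., b d is a basis of V. *)
Definition has_dim (V : bd_fun -> Prop) (d : nat) : Prop :=
  exists b : nat -> bd_fun,
    (forall i, (1 <= i <= d)%nat -> V (b i)) /\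
    (forall c, (forall e x, lin_comb d c b e x = 0) ->
       forall i, (1 <= i <= d)%nat -> c i = 0) /\
    (forall phi, V phi -> exists c, forall e x, phi e x = lin_comb d c b e x).

(* sigma 0 <= sigma 1 <= ... lists the eigenvalues with multiplicity: each
   real s occurs exactly as often as the dimension of its eigenspace (zero
   times if s is not an eigenvalue).  At most one sequence has this property. *)
Definition steklov_spectrum (T : R) (g : metric) (sigma : nat -> R) : Prop :=
  (forall k, sigma k <= sigma (S k)) /\
  forall s, exists l : list nat,
    NoDup l /\ (forall k, In k l <-> sigma k = s) /\
    has_dim (steklov_eigenspace T g s) (length l).

Definition steklov (T : R) (g : metric) : nat -> R :=
  epsilon (inhabits (fun _ => 0)) (steklov_spectrum T g).

Definition normalized_steklov (T : R) (g : metric) (k : nat) : R :=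
  steklov T g k * boundary_length T g.

Definition rotationally_symmetric (T : R) (g : metric) : Prop :=
  0 < T /\
  exists f, smooth_on 0 T f /\ (forall t, 0 <= t <= T -> 0 < f t) /\
    forall t x, 0 <= t <= T ->
      g_tt g t x = f t ^ 2 /\ g_th g t x = 0 /\ g_hh g t x = f t ^ 2.

(* The pullback of the Euclidean metric of R^3 by (X, Y, Z). *)
Definition induced_metric (X Y Z : R -> R -> R) : metric := {|
  g_tt t x := d_t X t x ^ 2 + d_t Y t x ^ 2 + d_t Z t x ^ 2;
  g_th t x := d_t X t x * d_th X t x + d_t Y t x * d_th Y t x
              + d_t Z t x * d_th Z t x;
  g_hh t x := d_th X t x ^ 2 + d_th Y t x ^ 2 + d_th Z t x ^ 2 |}.

Definition catenoid_X (n : nat) (t x : R) : R := INR n * t.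
Definition catenoid_Y (n : nat) (t x : R) : R := cosh (INR n * t) * cos (INR n * x).
Definition catenoid_Z (n : nat) (t x : R) : R := cosh (INR n * t) * sin (INR n * x).

Definition coth (s : R) : R := cosh s / sinh s.

(* T_{2,0}(1), the unique positive root of s = coth s. *)
Definition T20 : R := epsilon (inhabits 0) (fun s => 0 < s /\ s = coth s).

Definition critical_height (n : nat) : R := 2 * T20 / INR n.

(* The parameter interval [-T20/n, T20/n] is translated to [0, 2 T20/n]. *)
Definition critical_catenoid (n : nat) : metric :=
  induced_metric (fun t => catenoid_X n (t - T20 / INR n))
                 (fun t => catenoid_Y n (t - T20 / INR n))
                 (fun t => catenoid_Z n (t - T20 / INR n)).

(* Main.v *)
Require Import Defs.
From Stdlib Require Import Reals List FinFun ClassicalEpsilon FunctionalExtensionality Lra Lia.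
From Coquelicot Require Import Coquelicot.
Import ListNotations.
Open Scope R_scope.

(** Write [a] for [T20] and [al], [be] for the values of the conformal factor at
    the two ends.  In dimension two harmonicity only depends on the conformal
    class, so harmonic functions separate into modes [p t * cos (k x)] and
    [p t * sin (k x)] with [p'' = k^2 p].  Eliminating [p] leaves, for every
    frequency [k], a problem on the two boundary values, with characteristic
    polynomial

      P_k s = al be s^2 - kappa_k (al + be) s + k^2,   kappa_k = k coth (k T)

    ([kappa_0 = 1 / T]).  Each of its roots [low_root k < high_root k] contributes
    one eigenvalue for [k = 0] and two for [k > 0], for the cosine and the sine.
    That nothing else occurs ([eigenspace_dim]) is the completeness of the
    trigonometric system ([fourier_complete]) applied to the boundary values of
    an eigenfunction, whose Fourier coefficients obey the linear relations of
    [dn_matrix].  Counting indices then tells on which side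
    of a level [sigma_m] lies ([steklov_upper], [steklov_lower]), since the
    multiplicities determine the sorted sequence.

    The maximal value is [4 pi n / a].  For the critical catenoid [al = be], the
    roots are [k tanh (k T / 2)] and [k coth (k T / 2)] up to the factor
    [1 / al], and at [T = 2 a / n] the level is reached at the same time by
    [high_root 0] and [low_root n]; only the [2 n - 1] indices of [low_root k],
    [k < n], lie below it ([catenoid_small_eigenvalue]).

    For the bound one needs [2 n] eigenvalues not above the level
    [2 n / (a (al + be))].  If the roots [low_root k] exceed it for the first
    time at [k = m1] and the roots [high_root k] at [k = m2], there are enough of
    them as soon as [m1 + m2 > n] ([many_small_eigenvalues]).  The larger roots
    cannot be ignored: when [T] is large each of them is close to the smaller
    root of the same frequency.  Suppose [m1 + m2 <= n].  Then [P_m1 > 0 >= P_m2]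
    at the level.  After scaling, the asymmetry of [al] and [be] contributes the
    same term to both polynomials; the difference is an upper bound for the slope
    of a chord of [y coth y].  But this slope is at least that of the chord from
    [0] with the same midpoint ([ycoth_chord]), which the monotonicity of
    [langevin] and of [langevin y / y] compares with its value in the catenoid
    configuration.  Cylinders shorter than the critical one need a separate, easier
    argument ([critical_frequencies]). *)

(** * Finite sums and the invariance of dimension *)

(** Sums are typed in the carrier of an abelian monoid, which [ring] and [field]
    do not recognise as [R]. *)
Ltac sum_ring := match goal with |- @eq _ ?a ?b => change (@eq R a b); ring end.
Ltac sum_field := match goal with |- @eq _ ?a ?b => change (@eq R a b); field end.

Lemma sum_n_m_last (a : nat -> R) (d : nat) :
  sum_n_m a 1 (S d) = sum_n_m a 1 d + a (S d).
Proof. rewrite sum_n_Sm by lia. reflexivity. Qed.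

Lemma sum_n_m_empty (a : nat -> R) : sum_n_m a 1 0 = 0.
Proof. rewrite sum_n_m_zero by lia. reflexivity. Qed.

Lemma sum_n_m_lin (a b : nat -> R) (x y : R) (d : nat) :
  sum_n_m (fun i => x * a i + y * b i) 1 d = x * sum_n_m a 1 d + y * sum_n_m b 1 d.
Proof.
  induction d as [|d IH]; [rewrite !sum_n_m_empty | rewrite !sum_n_m_last, IH]; sum_ring.
Qed.

Lemma sum_n_m_scale (x : R) (a : nat -> R) (d : nat) :
  sum_n_m (fun i => x * a i) 1 d = x * sum_n_m a 1 d.
Proof.
  induction d as [|d IH]; [rewrite !sum_n_m_empty | rewrite !sum_n_m_last, IH]; sum_ring.
Qed.

Lemma sum_n_m_exchange (a : nat -> nat -> R) (d e : nat) :
  sum_n_m (fun i => sum_n_m (a i) 1 e) 1 d =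
  sum_n_m (fun r => sum_n_m (fun i => a i r) 1 d) 1 e.
Proof.
  induction d as [|d IH].
  - rewrite sum_n_m_empty. rewrite (sum_n_m_ext _ (fun _ => 0 * 0)).
    + rewrite sum_n_m_scale. sum_ring.
    + intros r. rewrite sum_n_m_empty. sum_ring.
  - rewrite sum_n_m_last, IH.
    rewrite (sum_n_m_ext (fun r => sum_n_m (fun i => a i r) 1 (S d))
              (fun r => 1 * sum_n_m (fun i => a i r) 1 d + 1 * a (S d) r)).
    + rewrite (sum_n_m_lin (fun r => sum_n_m (fun i => a i r) 1 d) (a (S d))). sum_ring.
    + intros r. rewrite sum_n_m_last. sum_ring.
Qed.

Definition skip (p i : nat) : nat := if Nat.ltb i p then i else S i.

Lemma sum_n_m_skip (a : nat -> R) (p d : nat) :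
  (1 <= p <= S d)%nat ->
  sum_n_m a 1 (S d) = a p + sum_n_m (fun i => a (skip p i)) 1 d.
Proof.
  revert p; induction d as [|d IH]; intros p hp.
  - assert (p = 1%nat) by lia; subst. rewrite sum_n_m_last, !sum_n_m_empty. sum_ring.
  - destruct (Nat.eq_dec p (S (S d))) as [->|np].
    + rewrite (sum_n_m_last a (S d)).
      rewrite (sum_n_m_ext_loc (fun i => a (skip (S (S d)) i)) a).
      * sum_ring.
      * intros k hk. unfold skip. destruct (Nat.ltb_spec k (S (S d))); [easy|lia].
    + rewrite sum_n_m_last, (IH p) by lia.
      rewrite (sum_n_m_last (fun i => a (skip p i))).
      unfold skip at 3. destruct (Nat.ltb_spec (S d) p); [lia|]. sum_ring.
Qed.

(** Gaussian elimination: a pivot in the last equation eliminates one unknown,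
    and the remaining equations are still outnumbered by the unknowns. *)
Lemma underdetermined_system (m : nat) :
  forall (d : nat) (M : nat -> nat -> R), (m < d)%nat ->
  exists c : nat -> R, (exists i, (1 <= i <= d)%nat /\ c i <> 0) /\
    forall r, (1 <= r <= m)%nat -> sum_n_m (fun i => c i * M i r) 1 d = 0.
Proof.
  induction m as [|m IH]; intros d M hd.
  - exists (fun _ => 1). split; [exists 1%nat; split; [lia|lra]|]. intros; lia.
  - destruct (excluded_middle_informative
      (exists p, (1 <= p <= d)%nat /\ M p (S m) <> 0)) as [[p [hp hM]]|none].
    + destruct d as [|d]; [lia|].
      destruct (IH d (fun i r => M (skip p i) r - M (skip p i) (S m) / M p (S m) * M p r))
        as [c [[i [hi hci]] hc]]; [lia|].
      set (s := sum_n_m (fun i => c i * M (skip p i) (S m)) 1 d).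
      set (c' := fun i => if Nat.eqb i p then - s / M p (S m)
                          else if Nat.ltb i p then c i else c (pred i)).
      assert (c'_p : c' p = - s / M p (S m)) by (unfold c'; now rewrite Nat.eqb_refl).
      assert (c'_skip : forall i, c' (skip p i) = c i).
      { intros k. unfold c', skip. destruct (Nat.ltb_spec k p).
        - destruct (Nat.eqb_spec k p); [lia|]. destruct (Nat.ltb_spec k p); [easy|lia].
        - destruct (Nat.eqb_spec (S k) p); [lia|].
          destruct (Nat.ltb_spec (S k) p); [lia|easy]. }
      exists c'. split.
      * exists (skip p i). rewrite c'_skip. split; [|easy].
        unfold skip; destruct (Nat.ltb_spec i p); lia.
      * intros r hr. rewrite (sum_n_m_skip _ p) by easy. rewrite c'_p.
        rewrite (sum_n_m_ext _ (fun i => c i * M (skip p i) r))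
          by (intros k; now rewrite c'_skip).
        destruct (Nat.eq_dec r (S m)) as [->|nr].
        { fold s. sum_field. easy. }
        assert (E := hc r ltac:(lia)).
        rewrite (sum_n_m_ext _ (fun i => 1 * (c i * M (skip p i) r)
                  + (- (M p r / M p (S m))) * (c i * M (skip p i) (S m)))) in E
          by (intros; simpl; sum_field; easy).
        rewrite (sum_n_m_lin (fun i => c i * M (skip p i) r)
                             (fun i => c i * M (skip p i) (S m))) in E.
        fold s in E. rewrite <- E. sum_field. easy.
    + destruct (IH d M ltac:(lia)) as [c [hc1 hc2]].
      exists c. split; [easy|]. intros r hr.
      destruct (Nat.eq_dec r (S m)) as [->|nr]; [|apply hc2; lia].
      rewrite (sum_n_m_ext_loc _ (fun _ => 0 * 0)).
      * rewrite sum_n_m_scale. sum_ring.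
      * intros k hk. destruct (Req_dec (M k (S m)) 0) as [->|h]; [sum_ring|].
        exfalso. apply none. now exists k.
Qed.

Lemma has_dim_le (V : bd_fun -> Prop) (d d' : nat) :
  has_dim V d -> has_dim V d' -> (d' <= d)%nat.
Proof.
  intros [b [_ [_ span]]] [b' [mem [indep _]]].
  destruct (Nat.le_gt_cases d' d) as [|lt]; [easy|exfalso].
  assert (coords : forall i, exists c : nat -> R, (1 <= i <= d')%nat ->
            forall e x, b' i e x = lin_comb d c b e x).
  { intros i. destruct (excluded_middle_informative (1 <= i <= d')%nat) as [h|h].
    - destruct (span (b' i) (mem i h)) as [c hc]. exists c; auto.
    - exists (fun _ => 0). easy. }
  set (M := fun i => proj1_sig (constructive_indefinite_description _ (coords i))).
  assert (hM : forall i, (1 <= i <= d')%nat -> forall e x, b' i e x = lin_comb d (M i) b e x).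
  { intros i. exact (proj2_sig (constructive_indefinite_description _ (coords i))). }
  destruct (underdetermined_system d d' M lt) as [c [[i [hi ci]] hc]].
  apply ci, (indep c); [|easy].
  intros e x. unfold lin_comb.
  rewrite (sum_n_m_ext_loc _ (fun i => sum_n_m (fun r => c i * M i r * b r e x) 1 d)).
  - rewrite (sum_n_m_exchange (fun i r => c i * M i r * b r e x)).
    rewrite (sum_n_m_ext_loc _ (fun _ => 0 * 0)).
    + rewrite sum_n_m_scale. sum_ring.
    + intros r hr.
      rewrite (sum_n_m_ext _ (fun i => b r e x * (c i * M i r))) by (intros; simpl; sum_ring).
      rewrite sum_n_m_scale, hc by easy. sum_ring.
  - intros k hk. rewrite hM by easy. unfold lin_comb.
    rewrite <- sum_n_m_scale. apply sum_n_m_ext. intros; simpl; sum_ring.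
Qed.

Lemma has_dim_unique (V : bd_fun -> Prop) (d d' : nat) :
  has_dim V d -> has_dim V d' -> d = d'.
Proof. intros h h'. apply Nat.le_antisymm; eapply has_dim_le; eauto. Qed.

(** * Enumerations of a multiset of reals *)

Definition fibre (f : nat -> R) (s : R) (l : list nat) : Prop :=
  NoDup l /\ forall k, In k l <-> f k = s.

Lemma fibre_length_ge (l : list nat) (f : nat -> R) (s : R) (J : list nat) :
  fibre f s l -> NoDup J -> (forall k, In k J -> f k = s) -> (length J <= length l)%nat.
Proof.
  intros [_ hl] nd hJ. apply NoDup_incl_length; [easy|].
  intros k hk. now apply hl, hJ.
Qed.

(** Choosing, value by value, as many preimages under [g] as there are under
    [f] turns a finite set of indices for [f] into one for [g] of the same size. *)
Lemma fibre_transfer (f g : nat -> R) :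
  (forall s, exists l l', fibre f s l /\ fibre g s l' /\ length l = length l') ->
  forall J, NoDup J -> exists J', NoDup J' /\ length J' = length J /\
    forall k, In k J' -> exists i, In i J /\ g k = f i.
Proof.
  intros same J. remember (length J) as N eqn:hN. revert J hN.
  induction N as [N IH] using (well_founded_induction Wf_nat.lt_wf). intros J hN nd.
  destruct J as [|i J0].
  { exists []. split; [constructor|]. split; [easy|]. intros k []. }
  set (test := fun k => if Req_EM_T (f k) (f i) then true else false).
  assert (htest : forall k, test k = true <-> f k = f i).
  { intros k. unfold test. destruct (Req_EM_T (f k) (f i)); split; easy. }
  set (J := i :: J0) in *.
  set (P := filter test J). set (Q := filter (fun k => negb (test k)) J).
  assert (len : (length P + length Q = length J)%nat).
  { unfold P, Q. apply filter_length. }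
  assert (Pne : (1 <= length P)%nat).
  { assert (In i P).
    { apply filter_In. split; [now left|now apply htest]. }
    destruct P; [easy|simpl; lia]. }
  destruct (IH (length Q) ltac:(lia) Q eq_refl (NoDup_filter _ nd))
    as [Q' [ndQ [lenQ hQ]]].
  destruct (same (f i)) as [l [l' [hl [[ndl hl'] eql]]]].
  assert (lenP : (length P <= length l)%nat).
  { apply (fibre_length_ge l f (f i)); [easy|now apply NoDup_filter|].
    intros k hk. apply filter_In in hk. now apply htest. }
  assert (sub : forall k, In k (firstn (length P) l') -> In k l').
  { intros k hk. rewrite <- (firstn_skipn (length P) l'). apply in_or_app. now left. }
  exists (firstn (length P) l' ++ Q'). split; [|split].
  - apply NoDup_app; [|easy|].
    + apply (NoDup_app_remove_r _ (skipn (length P) l')). now rewrite firstn_skipn.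
    + intros k hk hk'. apply sub, hl' in hk. destruct (hQ k hk') as [j [hj gj]].
      apply filter_In in hj. destruct hj as [_ hj].
      assert (test j = true) by (apply htest; congruence).
      rewrite H in hj. easy.
  - rewrite length_app, length_firstn. lia.
  - intros k hk. apply in_app_or in hk. destruct hk as [hk|hk].
    + exists i. split; [now left|]. now apply hl', sub.
    + destruct (hQ k hk) as [j [hj gj]]. exists j. split; [|easy].
      now apply filter_In in hj.
Qed.

(** The index set of the terms below any level is finite, so that a smallest
    unused term always exists; taking it again and again sorts the family. *)
Section Sorting.
Variable lam : nat -> R.
Hypothesis proper : forall M, exists N, forall i, lam i <= M -> (i < N)%nat.

Lemma minimum_outside (used : list nat) :
  exists i, ~ In i used /\ forall j, ~ In j used -> lam i <= lam j.
Proof.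
  assert (fresh : exists i0, ~ In i0 used).
  { exists (S (list_max used)). intros h.
    assert (List.Forall (fun k => (k <= list_max used)%nat) used)
      by (apply list_max_le; lia).
    rewrite Forall_forall in H. specialize (H _ h). lia. }
  destruct fresh as [i0 h0].
  destruct (proper (lam i0)) as [N hN].
  assert (search : forall n, exists i, ~ In i used /\ lam i <= lam i0 /\
            forall j, (j < n)%nat -> ~ In j used -> lam i <= lam j).
  { induction n as [|n [i [h1 [h2 h3]]]].
    - exists i0. split; [easy|]. split; [lra|]. intros; lia.
    - destruct (excluded_middle_informative (~ In n used /\ lam n < lam i)) as [[hu hl]|h].
      + exists n. split; [easy|]. split; [lra|]. intros j hj nj.
        destruct (Nat.eq_dec j n) as [->|]; [lra|].
        specialize (h3 j ltac:(lia) nj). lra.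
      + exists i. split; [easy|]. split; [easy|]. intros j hj nj.
        destruct (Nat.eq_dec j n) as [->|]; [|apply h3; [lia|easy]].
        destruct (Rle_dec (lam i) (lam n)); [easy|]. exfalso. apply h. split; [easy|lra]. }
  destruct (search N) as [i [h1 [h2 h3]]]. exists i. split; [easy|].
  intros j nj. destruct (Rle_dec (lam j) (lam i0)) as [h|h].
  - now apply h3; [apply hN|].
  - lra.
Qed.

Definition next (used : list nat) : nat :=
  proj1_sig (constructive_indefinite_description _ (minimum_outside used)).

Lemma next_spec (used : list nat) :
  ~ In (next used) used /\ forall j, ~ In j used -> lam (next used) <= lam j.
Proof. exact (proj2_sig (constructive_indefinite_description _ (minimum_outside used))). Qed.

Fixpoint chosen (k : nat) : list nat :=
  match k with O => [] | S k => next (chosen k) :: chosen k end.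

Definition sorting (k : nat) : nat := next (chosen k).

Lemma sorting_fresh k : ~ In (sorting k) (chosen k).
Proof. apply next_spec. Qed.

Lemma sorting_min k j : ~ In j (chosen k) -> lam (sorting k) <= lam j.
Proof. apply next_spec. Qed.

Lemma in_chosen k i : In i (chosen k) <-> exists m, (m < k)%nat /\ sorting m = i.
Proof.
  induction k as [|k IH]; simpl.
  - split; [easy|]. intros [m [h _]]; lia.
  - rewrite IH. split.
    + intros [h|[m [h1 h2]]]; [exists k; split; [lia|easy]|exists m; split; [lia|easy]].
    + intros [m [h1 h2]]. destruct (Nat.eq_dec m k) as [->|]; [now left|].
      right. exists m. split; [lia|easy].
Qed.

Lemma sorting_mono k : lam (sorting k) <= lam (sorting (S k)).
Proof.
  apply sorting_min. intros h. apply (sorting_fresh (S k)). simpl. now right.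
Qed.

Lemma sorting_inj k m : sorting k = sorting m -> k = m.
Proof.
  assert (W : forall k m, (k < m)%nat -> sorting k <> sorting m).
  { intros k0 m0 h e. apply (sorting_fresh m0), in_chosen. now exists k0. }
  intros e. destruct (Nat.lt_trichotomy k m) as [h|[h|h]]; [|easy|].
  - now apply W in h.
  - apply W in h. now symmetry in e.
Qed.

Lemma chosen_NoDup k : NoDup (chosen k).
Proof. induction k; simpl; constructor; [apply sorting_fresh|easy]. Qed.

Lemma chosen_length k : length (chosen k) = k.
Proof. induction k; simpl; congruence. Qed.

Lemma sorting_surj i : exists k, sorting k = i.
Proof.
  destruct (excluded_middle_informative (exists k, sorting k = i)) as [h|h]; [easy|exfalso].
  destruct (proper (lam i)) as [N hN].
  assert (incl (chosen (S N)) (seq 0 N)).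
  { intros j hj. apply in_chosen in hj. destruct hj as [m [_ <-]].
    apply in_seq. split; [lia|]. apply hN, sorting_min. rewrite in_chosen.
    intros [m' [_ e]]. apply h. now exists m'. }
  apply NoDup_incl_length in H; [|apply chosen_NoDup].
  rewrite chosen_length, length_seq in H. lia.
Qed.

Lemma sorting_fibre s l : fibre lam s l ->
  exists l', fibre (fun k => lam (sorting k)) s l' /\ length l' = length l.
Proof.
  intros [nd hl].
  set (inv := fun i => proj1_sig (constructive_indefinite_description _ (sorting_surj i))).
  assert (hinv : forall i, sorting (inv i) = i).
  { intros i. exact (proj2_sig (constructive_indefinite_description _ (sorting_surj i))). }
  exists (map inv l). split; [split|apply length_map].
  - apply Injective_map_NoDup; [|easy].
    intros x y e. rewrite <- (hinv x), <- (hinv y). now f_equal.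
  - intros k. rewrite in_map_iff. split.
    + intros [i [<- hi]]. rewrite hinv. now apply hl.
    + intros e. exists (sorting k). split; [|now apply hl].
      apply sorting_inj. apply hinv.
Qed.
End Sorting.

(** An explicit, unsorted enumeration of the eigenvalues decides on which side
    of a level the [m]-th eigenvalue lies; the sorting only serves to know that
    the sequence selected in [steklov] has the property that defines it. *)
Section Counting.
Variables (T : R) (g : metric) (lam : nat -> R).
Hypothesis proper : forall M, exists N, forall i, lam i <= M -> (i < N)%nat.
Hypothesis dims : forall s, exists l, fibre lam s l /\
  has_dim (steklov_eigenspace T g s) (length l).

Lemma steklov_is_spectrum : steklov_spectrum T g (steklov T g).
Proof.
  unfold steklov. apply epsilon_spec.
  exists (fun k => lam (sorting lam proper k)). split.
  - intros k. apply sorting_mono.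
  - intros s. destruct (dims s) as [l [hl hd]].
    destruct (sorting_fibre lam proper s l hl) as [l' [[nd hl'] len]].
    exists l'. rewrite len. easy.
Qed.

Lemma steklov_fibres s : exists l l', fibre lam s l /\ fibre (steklov T g) s l' /\
  length l = length l'.
Proof.
  destruct (dims s) as [l [hl hd]].
  destruct (proj2 steklov_is_spectrum s) as [l' [nd [hl' hd']]].
  exists l, l'. split; [easy|]. split; [easy|]. eapply has_dim_unique; eauto.
Qed.

Lemma steklov_mono i j : (i <= j)%nat -> steklov T g i <= steklov T g j.
Proof.
  induction 1 as [|j _ IH]; [lra|].
  assert (h := proj1 steklov_is_spectrum j). lra.
Qed.

Lemma steklov_upper (m : nat) (M : R) (J : list nat) :
  NoDup J -> (m < length J)%nat -> (forall i, In i J -> lam i <= M) ->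
  steklov T g m <= M.
Proof.
  intros nd len hJ. destruct (Rle_dec (steklov T g m) M) as [|h]; [easy|exfalso].
  destruct (fibre_transfer lam (steklov T g) steklov_fibres J nd) as [J' [nd' [len' hJ']]].
  assert (incl J' (seq 0 m)).
  { intros k hk. destruct (hJ' k hk) as [i [hi e]]. specialize (hJ i hi).
    apply in_seq. split; [lia|]. destruct (Nat.le_gt_cases m k) as [hmk|]; [|lia].
    apply steklov_mono in hmk. lra. }
  apply NoDup_incl_length in H; [|easy]. rewrite length_seq in H. lia.
Qed.

Lemma steklov_lower (m : nat) (M : R) :
  (forall J, NoDup J -> (forall i, In i J -> lam i < M) -> (length J <= m)%nat) ->
  M <= steklov T g m.
Proof.
  intros hJ. destruct (Rle_dec M (steklov T g m)) as [|h]; [easy|exfalso].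
  destruct (fibre_transfer (steklov T g) lam) with (J := seq 0 (S m)) as [J' [nd [len hJ']]].
  - intros s. destruct (steklov_fibres s) as [l [l' [h1 [h2 h3]]]].
    exists l', l. auto.
  - apply seq_NoDup.
  - rewrite length_seq in len.
    assert (length J' <= m)%nat; [|lia]. apply hJ; [easy|].
    intros k hk. destruct (hJ' k hk) as [i [hi e]]. apply in_seq in hi.
    assert (hm : (i <= m)%nat) by lia. apply steklov_mono in hm. lra.
Qed.
End Counting.

(** * Hyperbolic inequalities *)

Lemma is_derive_sinh (x : R) : is_derive sinh x (cosh x).
Proof. apply is_derive_Reals, derivable_pt_lim_sinh. Qed.

Lemma le_of_derive_nonneg (f df : R -> R) (a b : R) : a <= b ->
  (forall x, a <= x <= b -> is_derive f x (df x)) ->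
  (forall x, a <= x <= b -> 0 <= df x) -> f a <= f b.
Proof.
  intros hab hf hdf.
  destruct (MVT_gen f a b df) as [c [hc e]].
  - intros x hx. apply hf. revert hx. rewrite Rmin_left, Rmax_right by lra. lra.
  - intros x hx. apply continuity_pt_filterlim.
    apply (ex_derive_continuous (V := R_NormedModule)).
    exists (df x). apply hf. revert hx. rewrite Rmin_left, Rmax_right by lra. lra.
  - rewrite Rmin_left, Rmax_right in hc by lra.
    assert (0 <= df c * (b - a)) by (apply Rmult_le_pos; [now apply hdf|lra]). lra.
Qed.

Lemma nonneg_of_derive_nonneg (f df : R -> R) :
  0 <= f 0 -> (forall x, is_derive f x (df x)) -> (forall x, 0 <= x -> 0 <= df x) ->
  forall x, 0 <= x -> 0 <= f x.
Proof.
  intros h0 hf hdf x hx. apply Rle_trans with (1 := h0).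
  apply le_of_derive_nonneg with df; [easy|auto|]. intros; apply hdf; lra.
Qed.

Lemma cosh_sqr (x : R) : cosh x ^ 2 = 1 + sinh x ^ 2.
Proof.
  unfold cosh, sinh. rewrite exp_Ropp. assert (h := exp_pos x). field. lra.
Qed.

Lemma sinh_add (x y : R) : sinh (x + y) = sinh x * cosh y + cosh x * sinh y.
Proof.
  unfold cosh, sinh. rewrite Ropp_plus_distr, !exp_plus. field.
Qed.

Lemma cosh_add (x y : R) : cosh (x + y) = cosh x * cosh y + sinh x * sinh y.
Proof.
  unfold cosh, sinh. rewrite Ropp_plus_distr, !exp_plus. field.
Qed.

Lemma sinh_neg (x : R) : sinh (- x) = - sinh x.
Proof. unfold sinh. rewrite Ropp_involutive. field. Qed.

Lemma cosh_neg (x : R) : cosh (- x) = cosh x.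
Proof. unfold cosh. rewrite Ropp_involutive. field. Qed.

Lemma cosh_pos (x : R) : 0 < cosh x.
Proof. unfold cosh. assert (h := exp_pos x). assert (h' := exp_pos (- x)). lra. Qed.

Lemma cosh_gt_sinh (x : R) : sinh x < cosh x.
Proof. unfold cosh, sinh. assert (h' := exp_pos (- x)). lra. Qed.

Lemma sinh_ge (x : R) : 0 <= x -> x <= sinh x.
Proof.
  intros hx.
  assert (0 <= sinh x - x); [|lra].
  revert x hx. apply nonneg_of_derive_nonneg with (fun x => cosh x - 1).
  - rewrite sinh_0. lra.
  - intros x. apply @is_derive_minus; [apply is_derive_sinh|apply @is_derive_id].
  - intros x hx. assert (h := cosh_sqr x). assert (h' := cosh_pos x). nra.
Qed.

Lemma sinh_pos (x : R) : 0 < x -> 0 < sinh x.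
Proof. intros h. assert (h' := sinh_ge x). lra. Qed.

Lemma coth_mul_sinh (x : R) : 0 < x -> coth x * sinh x = cosh x.
Proof. intros h. assert (h' := sinh_pos x h). unfold coth. field. lra. Qed.

Lemma coth_gt_1 (x : R) : 0 < x -> 1 < coth x.
Proof.
  intros h. assert (h' := sinh_pos x h). assert (e := coth_mul_sinh x h).
  assert (l := cosh_gt_sinh x). nra.
Qed.

Lemma coth_decreasing (x y : R) : 0 < x -> x <= y -> coth y <= coth x.
Proof.
  intros hx hxy. unfold coth.
  assert (s1 := sinh_pos x hx). assert (s2 := sinh_pos y ltac:(lra)).
  apply Rmult_le_reg_r with (sinh x * sinh y); [nra|].
  replace (cosh y / sinh y * (sinh x * sinh y)) with (cosh y * sinh x) by (field; lra).
  replace (cosh x / sinh x * (sinh x * sinh y)) with (cosh x * sinh y) by (field; lra).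
  assert (h := sinh_ge (y - x) ltac:(lra)).
  unfold Rminus in h. rewrite sinh_add, sinh_neg, cosh_neg in h. lra.
Qed.

Lemma coth_double (x : R) : 0 < x -> coth (2 * x) = (coth x + / coth x) / 2.
Proof.
  intros h. assert (h' := sinh_pos x h). assert (h'' := cosh_pos x).
  unfold coth. replace (2 * x) with (x + x) by ring. rewrite sinh_add, cosh_add.
  field. repeat split; nra.
Qed.

(** The Langevin function; [langevin y] is the slope of the chord of
    [y * coth y] from [0], where that function takes the value [1]. *)
Definition langevin (y : R) : R := coth y - / y.

Lemma is_derive_langevin (y : R) : 0 < y ->
  is_derive langevin y (/ y ^ 2 - / sinh y ^ 2).
Proof.
  intros h. assert (h' := sinh_pos y h).
  unfold langevin, coth. auto_derive.
  - lra.
  - transitivity (/ y ^ 2 + 1 - cosh y ^ 2 / sinh y ^ 2); [field; lra|].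
    rewrite cosh_sqr. field. lra.
Qed.

Lemma langevin_increasing (x y : R) : 0 < x -> x <= y -> langevin x <= langevin y.
Proof.
  intros hx hxy.
  apply le_of_derive_nonneg with (fun y => / y ^ 2 - / sinh y ^ 2); [easy| |].
  - intros z hz. apply is_derive_langevin. lra.
  - intros z hz. assert (h := sinh_ge z ltac:(lra)).
    assert (/ sinh z ^ 2 <= / z ^ 2); [|lra].
    apply Rinv_le_contravar; nra.
Qed.

(** Up to a positive factor the difference of the two sides is the derivative of
    [- langevin y / y].  Each of the functions in the proof vanishes at [0] and
    has the one before it, which is nonnegative, as derivative. *)
Lemma two_sinh_sqr_le (y : R) : 0 <= y -> 2 * sinh y ^ 2 <= y ^ 2 + y * (sinh y * cosh y).
Proof.
  intros hy.
  assert (third : forall y, 0 <= y ->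
    0 <= 4 * y * (cosh y ^ 2 + sinh y ^ 2) - 4 * (sinh y * cosh y)).
  { apply nonneg_of_derive_nonneg with (fun y => 16 * y * (sinh y * cosh y)).
    - rewrite sinh_0. lra.
    - intros x. auto_derive.
      + easy.
      + ring.
    - intros x hx. assert (h := sinh_ge x hx). assert (h' := cosh_pos x). 
      apply Rmult_le_pos; [lra|]. apply Rmult_le_pos; lra. }
  assert (second : forall y, 0 <= y -> 0 <= 4 * y * (sinh y * cosh y) - 4 * sinh y ^ 2).
  { apply nonneg_of_derive_nonneg with
      (fun y => 4 * y * (cosh y ^ 2 + sinh y ^ 2) - 4 * (sinh y * cosh y)); [|  |easy].
    - rewrite sinh_0. lra.
    - intros x. auto_derive.
      + easy.
      + ring. }
  assert (first : forall y, 0 <= y ->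
    0 <= 2 * y + y * (cosh y ^ 2 + sinh y ^ 2) - 3 * (sinh y * cosh y)).
  { apply nonneg_of_derive_nonneg with
      (fun y => 4 * y * (sinh y * cosh y) - 4 * sinh y ^ 2); [| |easy].
    - rewrite sinh_0. lra.
    - intros x. auto_derive.
      + easy.
      +
        assert (e := cosh_sqr x). nra. }
  assert (zeroth : forall y, 0 <= y -> 0 <= y ^ 2 + y * (sinh y * cosh y) - 2 * sinh y ^ 2).
  { apply nonneg_of_derive_nonneg with
      (fun y => 2 * y + y * (cosh y ^ 2 + sinh y ^ 2) - 3 * (sinh y * cosh y)); [| |easy].
    - rewrite sinh_0. lra.
    - intros x. auto_derive.
      + easy.
      + ring. }
  specialize (zeroth y hy). lra.
Qed.

Lemma langevin_ratio_decreasing (x y : R) : 0 < x -> x <= y ->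
  langevin y / y <= langevin x / x.
Proof.
  intros hx hxy.
  assert (- (langevin x / x) <= - (langevin y / y)); [|lra].
  apply le_of_derive_nonneg with
    (f := fun y => - (langevin y / y))
    (df := fun y => (langevin y - y * (/ y ^ 2 - / sinh y ^ 2)) / y ^ 2); [easy| |].
  - intros z hz. assert (d := is_derive_langevin z ltac:(lra)). auto_derive.
    + repeat split; [eexists; exact d|lra].
      replace (Derive _ z) with (/ z ^ 2 - / sinh z ^ 2)
        by (symmetry; apply is_derive_unique, d).
      assert (h := sinh_pos z ltac:(lra)). field. lra.
  - intros z hz. assert (h := sinh_pos z ltac:(lra)).
    assert (k := two_sinh_sqr_le z ltac:(lra)).
    replace ((langevin z - z * (/ z ^ 2 - / sinh z ^ 2)) / z ^ 2)
      with ((z ^ 2 + z * (sinh z * cosh z) - 2 * sinh z ^ 2) / (sinh z ^ 2 * z ^ 3))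
      by (unfold langevin, coth; field; lra).
    apply Rdiv_le_0_compat; [lra|]. apply Rmult_lt_0_compat; apply pow_lt; lra.
Qed.

(** Extended by continuity to [0], so that frequency [0] needs no separate formula. *)
Definition ycoth (y : R) : R := if Req_EM_T y 0 then 1 else y * coth y.

Lemma ycoth_0 : ycoth 0 = 1.
Proof. unfold ycoth. now destruct (Req_EM_T 0 0). Qed.

Lemma ycoth_pos (y : R) : 0 < y -> ycoth y = y * coth y.
Proof. intros h. unfold ycoth. destruct (Req_EM_T y 0); [lra|easy]. Qed.

Lemma ycoth_ge (y : R) : 0 <= y -> y <= ycoth y.
Proof.
  intros [h|<-]; [|rewrite ycoth_0; lra].
  rewrite ycoth_pos by easy. assert (h' := coth_gt_1 y h). nra.
Qed.

Lemma ycoth_ge_1 (y : R) : 0 <= y -> 1 <= ycoth y.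
Proof.
  intros [h|<-]; [|rewrite ycoth_0; lra].
  rewrite ycoth_pos by easy.
  assert (k := two_sinh_sqr_le y ltac:(lra)).
  assert (s := sinh_pos y h). assert (sy := sinh_ge y ltac:(lra)).
  assert (c := coth_mul_sinh y h). assert (c' := coth_gt_1 y h).
  assert (y ^ 2 <= sinh y ^ 2) by nra.
  apply Rmult_le_reg_r with (sinh y ^ 2); [nra|].
  replace (y * coth y * sinh y ^ 2) with (y * (sinh y * cosh y)) by (rewrite <- c; ring).
  lra.
Qed.

Lemma ycoth_le (y : R) : 0 <= y -> ycoth y <= 1 + y.
Proof.
  intros [h|<-]; [|rewrite ycoth_0; lra].
  rewrite ycoth_pos by easy. assert (s := sinh_pos y h). assert (s' := sinh_ge y ltac:(lra)).
  assert (e : cosh y - sinh y <= 1).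
  { unfold cosh, sinh. assert (exp (- y) < exp 0) by (apply exp_increasing; lra).
    rewrite exp_0 in H. lra. }
  apply Rmult_le_reg_r with (sinh y); [easy|].
  rewrite Rmult_assoc, coth_mul_sinh by easy. nra.
Qed.

(** Among the chords of [ycoth] whose end points have a given sum, the one that
    starts at [0] is the least steep: the mean of its concave derivative over
    an interval with fixed centre decreases as the interval grows.  In terms of
    [S = x + y] and [t = x - y] the comparison is the monotonicity in [t] of
    the function [h] below. *)
Lemma ycoth_chord (x y : R) : 0 <= y < x ->
  (x - y) * langevin (x + y) <= ycoth x - ycoth y.
Proof.
  intros [[hy|<-] hxy].
  - rewrite !ycoth_pos by lra.
    set (S := x + y). set (D := x - y).
    assert (sS := sinh_pos S ltac:(unfold S; lra)).
    assert (key : sinh S - S * (sinh S / S) - langevin S * (cosh S - cosh S)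
               <= sinh S - S * (sinh D / D) - langevin S * (cosh S - cosh D)).
    { set (h := fun t => sinh S - S * (sinh t / t) - langevin S * (cosh S - cosh t)).
      change (h S <= h D). assert (- h D <= - h S); [|lra].
      apply le_of_derive_nonneg with (f := fun t => - h t)
        (df := fun t => sinh t * (S * (langevin t / t) - langevin S));
        [unfold S, D; lra| |].
      - intros t ht. assert (0 < t) by (unfold D in ht; lra). unfold h. auto_derive.
        + lra.
      +
          assert (st := sinh_pos t ltac:(lra)). unfold langevin at 2. unfold coth.
          field. lra.
      - intros t ht. assert (0 < t) by (unfold D in ht; lra).
        assert (st := sinh_pos t ltac:(lra)).
        assert (r := langevin_ratio_decreasing t S ltac:(lra) ltac:(lra)).
        apply Rmult_le_pos; [lra|].
        assert (pS : 0 < S) by (unfold S; lra).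
        apply (Rmult_le_compat_l S) in r; [|lra].
        replace (S * (langevin S / S)) with (langevin S) in r by (field; lra). lra. }
    assert (pS : 0 < S) by (unfold S; lra). assert (pD : 0 < D) by (unfold D; lra).
    replace (S * (sinh S / S)) with (sinh S) in key by (field; lra).
    assert (key2 : D * langevin S * (cosh S - cosh D) <= D * sinh S - S * sinh D).
    { apply (Rmult_le_compat_l D) in key; [|lra].
      replace (D * (sinh S - S * (sinh D / D) - langevin S * (cosh S - cosh D)))
        with (D * sinh S - S * sinh D - D * langevin S * (cosh S - cosh D)) in key
        by (field; lra). lra. }
    assert (sx := sinh_pos x ltac:(lra)). assert (sy := sinh_pos y ltac:(lra)).
    assert (eS : sinh S = sinh x * cosh y + cosh x * sinh y) by apply sinh_add.
    assert (eD : sinh D = sinh x * cosh y - cosh x * sinh y).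
    { unfold D, Rminus. rewrite sinh_add, sinh_neg, cosh_neg. ring. }
    assert (eC : cosh S - cosh D = 2 * (sinh x * sinh y)).
    { unfold S, D, Rminus. rewrite !cosh_add, sinh_neg, cosh_neg. ring. }
    rewrite eC in key2. rewrite eS, eD in key2.
    apply Rmult_le_reg_r with (2 * (sinh x * sinh y)); [nra|].
    replace ((x * coth x - y * coth y) * (2 * (sinh x * sinh y)))
      with (2 * (x * (cosh x * sinh y) - y * (cosh y * sinh x)))
      by (rewrite <- (coth_mul_sinh x), <- (coth_mul_sinh y) by lra; ring).
    unfold S, D in *. lra.
  - rewrite ycoth_0, ycoth_pos, Rplus_0_r, Rminus_0_r by lra.
    apply Req_le. unfold langevin. field. lra.
Qed.

(** * The critical height *)

Lemma coth_fixpoint_exists : exists s, 0 < s /\ s = coth s.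
Proof.
  destruct (Ranalysis5.IVT_interv (fun s => s * sinh s - cosh s) 1 2) as [s [hs e]].
  - intros s hs. apply derivable_continuous_pt.
    apply derivable_pt_minus; [apply derivable_pt_mult; [apply derivable_pt_id|]|].
    + exists (cosh s). apply derivable_pt_lim_sinh.
    + exists (sinh s). apply derivable_pt_lim_cosh.
  - lra.
  - assert (h := cosh_gt_sinh 1). lra.
  - unfold sinh, cosh. assert (h : 3 <= exp 2) by (assert (h := exp_ineq1_le 2); lra).
    assert (h' : exp (- (2)) * exp 2 = 1) by (rewrite <- exp_plus, <- exp_0; f_equal; lra).
    assert (h'' := exp_pos (- (2))). assert (3 * exp (- (2)) <= exp (- (2)) * exp 2) by nra. lra.
  - exists s. assert (p := sinh_pos s ltac:(lra)). split; [lra|].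
    unfold coth. apply Rmult_eq_reg_r with (sinh s); [|lra]. field_simplify; lra.
Qed.

Lemma T20_spec : 0 < T20 /\ T20 = coth T20.
Proof. unfold T20. apply epsilon_spec, coth_fixpoint_exists. Qed.

Lemma T20_lt_2 : T20 < 2.
Proof.
  destruct T20_spec as [p e]. destruct (Rlt_dec T20 2) as [|h]; [easy|exfalso].
  assert (b := ycoth_le T20 ltac:(lra)). rewrite ycoth_pos, <- e in b by easy. nra.
Qed.

Lemma langevin_2_T20 : langevin (2 * T20) = T20 / 2.
Proof.
  destruct T20_spec as [p e]. unfold langevin. rewrite coth_double, <- e by easy.
  field. lra.
Qed.

(** Contradiction that rules out too few eigenvalues below the critical level.
    Up to a factor, [w^2 + z^2 - w * ycoth (2 * z) - d * w^2] is the
    characteristic polynomial of frequency [z] at the level [w]; the constraint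
    [z1 + z2 <= T20 * w] says that the two frequencies sum up to at most [n].
    For [w >= 1] subtracting the two sign conditions removes the asymmetry [d]
    of the metric and leaves the slope of a chord of [ycoth].  For [w < 1] the
    polynomial at [z1] factors, when [d] is dropped, as
    [(w - z1 / coth z1) * (w - z1 * coth z1)]; the second factor is negative
    because [w < z1], the first is not because [z1 <= T20 * w < T20]. *)
Lemma critical_frequencies (w z1 z2 d : R) :
  0 < w -> 0 <= d -> 0 <= z2 -> z1 + z2 <= T20 * w -> w < z1 ->
  0 < w ^ 2 + z1 ^ 2 - w * ycoth (2 * z1) - d * w ^ 2 ->
  w ^ 2 + z2 ^ 2 - w * ycoth (2 * z2) - d * w ^ 2 <= 0 ->
  (w < 1 -> z2 = 0) -> False.
Proof.
  intros hw hd hz2 sum hz1 pos neg small.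
  destruct T20_spec as [pa ea]. assert (a2 := T20_lt_2).
  destruct (Rlt_dec w 1) as [h1|h1].
  - rewrite (small h1) in *. clear small neg.
    assert (za : z1 <= T20) by nra. assert (pz : 0 < z1) by lra.
    assert (dec : T20 <= coth z1) by (rewrite ea; apply coth_decreasing; lra).
    rewrite ycoth_pos, coth_double in pos by lra.
    assert (c1 := coth_gt_1 z1 pz). set (c := coth z1) in *.
    assert (fac : w ^ 2 + z1 ^ 2 - w * (2 * z1 * ((c + / c) / 2))
             = (w - z1 / c) * (w - z1 * c)) by (field; lra).
    rewrite fac in pos.
    assert (z1 / c <= w).
    { apply Rmult_le_reg_r with c; [lra|].
      replace (z1 / c * c) with z1 by (field; lra). nra. }
    assert (w - z1 * c < 0) by nra. nra.
  - set (y := z1 + z2) in *.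
    assert (lt : z2 < z1) by (unfold y in *; nra).
    assert (chord := ycoth_chord (2 * z1) (2 * z2) ltac:(lra)).
    replace (2 * z1 + 2 * z2) with (2 * y) in chord by (unfold y; ring).
    assert (py : 0 < y) by (unfold y; lra).
    assert (r := langevin_ratio_decreasing (2 * y) (2 * (T20 * w)) ltac:(lra) ltac:(lra)).
    assert (i := langevin_increasing (2 * T20) (2 * (T20 * w)) ltac:(lra) ltac:(nra)).
    rewrite langevin_2_T20 in i.
    assert (low : y <= 2 * w * langevin (2 * y)).
    { assert (q : T20 / 2 / (2 * (T20 * w)) <= langevin (2 * y) / (2 * y)).
      { apply Rle_trans with (2 := r). apply Rmult_le_compat_r; [|easy].
        left. apply Rinv_0_lt_compat. nra. }
      apply (Rmult_le_compat_l (4 * w * y)) in q; [|nra].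
      replace (4 * w * y * (T20 / 2 / (2 * (T20 * w)))) with y in q by (field; nra).
      replace (4 * w * y * (langevin (2 * y) / (2 * y))) with (2 * w * langevin (2 * y)) in q
        by (field; lra). easy. }
    assert (w * ((2 * z1 - 2 * z2) * langevin (2 * y)) <= w * (ycoth (2 * z1) - ycoth (2 * z2)))
      by (apply Rmult_le_compat_l; lra).
    assert ((z1 - z2) * y <= (z1 - z2) * (2 * w * langevin (2 * y)))
      by (apply Rmult_le_compat_l; lra).
    assert ((z1 - z2) * y = z1 ^ 2 - z2 ^ 2) by (unfold y; ring). lra.
Qed.

(** * Fourier series on the circle *)

Definition cont (f : R -> R) : Prop := forall x, continuous f x.

Lemma cont_of_derive (f df : R -> R) : (forall x, is_derive f x (df x)) -> cont f.
Proof.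
  intros h x. apply (ex_derive_continuous (V := R_NormedModule)). exists (df x). apply h.
Qed.

Lemma cont_eps_delta (f : R -> R) (x0 eps : R) : cont f -> 0 < eps ->
  exists d, 0 < d /\ forall x, Rabs (x - x0) < d -> Rabs (f x - f x0) < eps.
Proof.
  intros hf heps.
  destruct (proj1 (continuity_pt_locally f x0)
              (proj2 (continuity_pt_filterlim f x0) (hf x0)) (mkposreal eps heps)) as [d hd].
  exists d. split; [apply cond_pos|]. intros x hx. now apply (hd x).
Qed.

Lemma cont_const (c : R) : cont (fun _ => c).
Proof. intros x. apply continuous_const. Qed.

Lemma cont_mult (f g : R -> R) : cont f -> cont g -> cont (fun x => f x * g x).
Proof. intros hf hg x. apply (continuous_mult f g); auto. Qed.

Lemma cont_lin (a b : R) (f g : R -> R) :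
  cont f -> cont g -> cont (fun x => a * f x + b * g x).
Proof.
  intros hf hg x. apply (continuous_plus (fun x => a * f x) (fun x => b * g x));
    apply cont_mult; try easy; apply cont_const.
Qed.

Lemma cont_ext (f g : R -> R) : (forall x, f x = g x) -> cont f -> cont g.
Proof. intros e hf x. now apply continuous_ext with f. Qed.

Lemma cont_ex_RInt (f : R -> R) (a b : R) : cont f -> ex_RInt f a b.
Proof. intros hf. apply (ex_RInt_continuous (V := R_CompleteNormedModule)). auto. Qed.

Lemma is_derive_mul (f g : R -> R) (x df dg : R) :
  is_derive f x df -> is_derive g x dg ->
  is_derive (fun t => f t * g t) x (df * g x + f x * dg).
Proof. intros hf hg. apply (is_derive_mult f g); [easy|easy|apply Rmult_comm]. Qed.

Lemma is_derive_eq (f : R -> R) (x a b : R) : is_derive f x a -> a = b -> is_derive f x b.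
Proof. now intros h <-. Qed.

Definition cint (f : R -> R) : R := RInt f 0 (2 * PI).

Lemma cint_ext (f g : R -> R) : (forall x, f x = g x) -> cint f = cint g.
Proof. intros e. apply RInt_ext. auto. Qed.

Lemma cint_lin (a b : R) (f g : R -> R) : cont f -> cont g ->
  cint (fun x => a * f x + b * g x) = a * cint f + b * cint g.
Proof.
  intros hf hg. unfold cint.
  assert (ef := cont_ex_RInt f 0 (2 * PI) hf). assert (eg := cont_ex_RInt g 0 (2 * PI) hg).
  apply is_RInt_unique.
  apply (is_RInt_plus (fun x => a * f x) (fun x => b * g x)).
  - apply (is_RInt_scal f). now apply (RInt_correct f).
  - apply (is_RInt_scal g). now apply (RInt_correct g).
Qed.

Lemma cint_scal (a : R) (f : R -> R) : cont f -> cint (fun x => a * f x) = a * cint f.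
Proof.
  intros hf. rewrite (cint_ext _ (fun x => a * f x + 0 * f x)) by (intros; ring).
  rewrite cint_lin by easy. ring.
Qed.

Lemma cint_const (c : R) : cint (fun _ => c) = 2 * PI * c.
Proof. unfold cint. rewrite RInt_const. change (scal (2 * PI - 0) c) with ((2 * PI - 0) * c). ring. Qed.

Lemma cint_derive (f df : R -> R) : (forall x, is_derive f x (df x)) -> cont df ->
  cint df = f (2 * PI) - f 0.
Proof.
  intros hf hdf. unfold cint. apply is_RInt_unique. apply (is_RInt_derive f df); auto.
Qed.

Lemma cint_le (f g : R -> R) : cont f -> cont g ->
  (forall x, 0 <= x <= 2 * PI -> f x <= g x) -> cint f <= cint g.
Proof.
  intros hf hg h. assert (p := PI_RGT_0).
  apply RInt_le; [lra|now apply cont_ex_RInt|now apply cont_ex_RInt|].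
  intros x hx. apply h. lra.
Qed.

Lemma cint_pos (f : R -> R) (x0 d : R) : cont f -> 0 < d ->
  0 < x0 - d -> x0 + d < 2 * PI ->
  (forall x, 0 <= x <= 2 * PI -> 0 <= f x) ->
  (forall x, x0 - d < x < x0 + d -> 0 < f x) -> 0 < cint f.
Proof.
  intros hf hd h1 h2 pos strict. unfold cint.
  assert (e : forall a b, ex_RInt f a b) by (intros; now apply cont_ex_RInt).
  rewrite <- (RInt_Chasles f 0 (x0 - d) (2 * PI)) by apply e.
  rewrite <- (RInt_Chasles f (x0 - d) (x0 + d) (2 * PI)) by apply e.
  assert (i1 : 0 <= RInt f 0 (x0 - d)) by (apply RInt_ge_0; [lra|apply e|intros; apply pos; lra]).
  assert (i3 : 0 <= RInt f (x0 + d) (2 * PI))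
    by (apply RInt_ge_0; [lra|apply e|intros; apply pos; lra]).
  assert (i2 : 0 < RInt f (x0 - d) (x0 + d)) by (apply RInt_gt_0; [lra|apply strict|auto]).
  unfold plus; simpl. lra.
Qed.

Definition freq (j : nat) : nat := Nat.div2 (S j).

(** The sequence 1, cos x, sin x, cos 2x, sin 2x, ... *)
Definition trig (j : nat) (x : R) : R :=
  if andb (Nat.even j) (negb (Nat.eqb j 0)) then sin (INR (freq j) * x) else cos (INR (freq j) * x).

Definition trig' (j : nat) (x : R) : R :=
  if andb (Nat.even j) (negb (Nat.eqb j 0)) then INR (freq j) * cos (INR (freq j) * x)
  else - (INR (freq j) * sin (INR (freq j) * x)).

Lemma is_derive_trig (j : nat) (x : R) : is_derive (trig j) x (trig' j x).
Proof. unfold trig, trig'. destruct (andb _ _); auto_derive; trivial; ring. Qed.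

Lemma is_derive_trig' (j : nat) (x : R) :
  is_derive (trig' j) x (- INR (freq j) ^ 2 * trig j x).
Proof. unfold trig, trig'. destruct (andb _ _); auto_derive; trivial; ring. Qed.

Lemma cont_trig (j : nat) : cont (trig j).
Proof. eapply cont_of_derive. apply is_derive_trig. Qed.

Lemma trig_period (j : nat) (x : R) : trig j (x + 2 * PI) = trig j x.
Proof.
  unfold trig. replace (INR (freq j) * (x + 2 * PI)) with (INR (freq j) * x + 2 * INR (freq j) * PI)
    by ring. now rewrite sin_period, cos_period.
Qed.

Lemma trig'_period (j : nat) (x : R) : trig' j (x + 2 * PI) = trig' j x.
Proof.
  unfold trig'. replace (INR (freq j) * (x + 2 * PI)) with (INR (freq j) * x + 2 * INR (freq j) * PI)
    by ring. now rewrite sin_period, cos_period.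
Qed.

Lemma trig_0 (x : R) : trig 0 x = 1.
Proof. unfold trig, freq. simpl. rewrite Rmult_0_l. apply cos_0. Qed.

Lemma freq_odd (k : nat) : freq (2 * k - 1) = k.
Proof.
  unfold freq. destruct k as [|k]; [easy|].
  replace (S (2 * S k - 1)) with (2 * S k)%nat by lia. apply Nat.div2_double.
Qed.

Lemma freq_even (k : nat) : freq (2 * k) = k.
Proof. unfold freq. apply Nat.div2_succ_double. Qed.

Lemma freq_cases (j : nat) : (j = 2 * freq j \/ j = 2 * freq j - 1 /\ 1 <= freq j)%nat.
Proof.
  destruct (Nat.even j) eqn:e.
  - apply Nat.even_spec in e. destruct e as [k ->]. rewrite freq_even. now left.
  - assert (o : Nat.odd j = true) by (unfold Nat.odd; now rewrite e).
    apply Nat.odd_spec in o. destruct o as [k ->].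
    replace (2 * k + 1)%nat with (2 * S k - 1)%nat by lia. rewrite freq_odd. right. lia.
Qed.

Lemma trig_odd (k : nat) (x : R) : trig (2 * k - 1) x = cos (INR k * x).
Proof.
  unfold trig. rewrite freq_odd. destruct k as [|k]; [easy|].
  replace (2 * S k - 1)%nat with (S (2 * k)) by lia.
  rewrite Nat.even_succ, Nat.odd_mul. easy.
Qed.

Lemma trig_even (k : nat) (x : R) : (1 <= k)%nat -> trig (2 * k) x = sin (INR k * x).
Proof.
  intros hk. unfold trig. rewrite freq_even, Nat.even_mul. destruct k; [lia|easy].
Qed.

Lemma cint_trig_sqr_pos (j : nat) : 0 < cint (fun x => trig j x * trig j x).
Proof.
  assert (p := PI_RGT_0).
  destruct (Nat.eq_dec j 0) as [->|nz].
  - rewrite (cint_ext _ (fun _ => 1)) by (intros; rewrite trig_0; ring).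
    rewrite cint_const. lra.
  - assert (hk : 1 <= INR (freq j)).
    { apply (le_INR 1). destruct (freq_cases j); lia. }
    (* Pythagoras expresses [trig j x ^ 2] by the derivative of [trig j * trig' j]. *)
    assert (pyth : forall x, INR (freq j) ^ 2 * trig j x ^ 2 + trig' j x ^ 2 = INR (freq j) ^ 2).
    { intros x. unfold trig, trig'. assert (h := sin2_cos2 (INR (freq j) * x)).
      unfold Rsqr in h. destruct (andb _ _); nra. }
    rewrite (cint_derive (fun x => x / 2 - trig j x * trig' j x / (2 * INR (freq j) ^ 2))).
    + assert (e := trig_period j 0). assert (e' := trig'_period j 0).
      rewrite Rplus_0_l in e, e'. rewrite e, e'. lra.
    + intros x. assert (d := is_derive_trig j x). assert (d' := is_derive_trig' j x).
      auto_derive.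
      * split; [eexists; exact d|]. split; [eexists; exact d'|easy].
      * replace (Derive _ x) with (trig' j x) by (symmetry; apply is_derive_unique, d).
        replace (Derive _ x) with (- INR (freq j) ^ 2 * trig j x)
          by (symmetry; apply is_derive_unique, d').
        specialize (pyth x).
        assert (trig' j x ^ 2 = INR (freq j) ^ 2 - INR (freq j) ^ 2 * trig j x ^ 2) by lra.
        transitivity (/ 2 - (trig' j x ^ 2 - INR (freq j) ^ 2 * trig j x ^ 2) / (2 * INR (freq j) ^ 2)).
        { field. lra. } rewrite H. field. lra.
    + apply cont_mult; apply cont_trig.
Qed.

(** Different frequencies are orthogonal because both functions solve
    [e'' = - k^2 e], so that their Wronskian has derivative a multiple of the
    product; the sine and cosine of one frequency because their product is the
    derivative of a square. *)
Lemma cint_trig_orthogonal (i j : nat) : i <> j -> cint (fun x => trig i x * trig j x) = 0.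
Proof.
  intros ne.
  assert (c := cont_mult _ _ (cont_trig i) (cont_trig j)).
  destruct (Nat.eq_dec (freq i) (freq j)) as [ef|nf].
  - assert (key : forall k, (1 <= k)%nat ->
      cint (fun x => trig (2 * k) x * trig (2 * k - 1) x) = 0).
    { intros k hk. assert (0 < INR k) by (apply lt_0_INR; lia).
      rewrite (cint_derive (fun x => trig (2 * k) x ^ 2 / (2 * INR k))).
      - assert (e := trig_period (2 * k) 0). rewrite Rplus_0_l in e. rewrite e. ring.
      - intros x. apply is_derive_ext with (fun x => sin (INR k * x) ^ 2 / (2 * INR k)).
        { intros t. now rewrite trig_even. }
        rewrite trig_even, trig_odd by easy. auto_derive; [easy|]. field. lra.
      - apply cont_mult; apply cont_trig. }
    destruct (freq_cases i) as [hi|[hi hi']], (freq_cases j) as [hj|[hj hj']];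
      try lia.
    + rewrite hi, hj, ef. apply key. lia.
    + rewrite hi, hj, ef. rewrite <- (key (freq j)) by lia. apply cint_ext. intros; ring.
  - assert (k : INR (freq j) ^ 2 - INR (freq i) ^ 2 <> 0).
    { intros h. apply nf, INR_eq. assert (h1 := pos_INR (freq i)). assert (h2 := pos_INR (freq j)).
      nra. }
    apply Rmult_eq_reg_l with (INR (freq j) ^ 2 - INR (freq i) ^ 2); [|easy].
    rewrite Rmult_0_r, <- cint_scal by easy.
    rewrite (cint_derive (fun x => trig' i x * trig j x - trig i x * trig' j x)).
    + assert (e1 := trig_period i 0). assert (e2 := trig_period j 0).
      assert (e3 := trig'_period i 0). assert (e4 := trig'_period j 0).
      rewrite Rplus_0_l in e1, e2, e3, e4. rewrite e1, e2, e3, e4. ring.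
    + intros x.
      assert (d1 := is_derive_trig i x). assert (d2 := is_derive_trig' i x).
      assert (d3 := is_derive_trig j x). assert (d4 := is_derive_trig' j x).
      eapply is_derive_eq.
      { apply (is_derive_minus (fun x => trig' i x * trig j x) (fun x => trig i x * trig' j x));
          apply is_derive_mul; eassumption. }
      unfold minus, plus, opp; simpl. ring.
    + apply cont_mult; [apply cont_const|easy].
Qed.

Inductive trig_poly : (R -> R) -> Prop :=
| trig_poly_cos k : trig_poly (fun x => cos (INR k * x))
| trig_poly_sin k : trig_poly (fun x => sin (INR k * x))
| trig_poly_lin a b f g : trig_poly f -> trig_poly g -> trig_poly (fun x => a * f x + b * g x)
| trig_poly_ext f g : (forall x, f x = g x) -> trig_poly f -> trig_poly g.

Lemma trig_poly_mul_cos_sin (h : R -> R) : trig_poly h ->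
  trig_poly (fun x => cos x * h x) /\ trig_poly (fun x => sin x * h x).
Proof.
  induction 1 as [k|k|a b f g _ [IHf IHf'] _ [IHg IHg']|f g e _ [IH IH']].
  - destruct k as [|k].
    + split.
      * apply trig_poly_ext with (2 := trig_poly_cos 1). intros x. simpl.
        rewrite Rmult_0_l, cos_0, !Rmult_1_l. ring.
      * apply trig_poly_ext with (2 := trig_poly_sin 1). intros x. simpl.
        rewrite Rmult_0_l, cos_0, !Rmult_1_l. ring.
    + split.
      * apply trig_poly_ext with (2 := trig_poly_lin (1/2) (1/2) _ _
          (trig_poly_cos (S (S k))) (trig_poly_cos k)).
        intros x. rewrite !S_INR.
        replace ((INR k + 1 + 1) * x) with ((INR k + 1) * x + x) by ring.
        replace (INR k * x) with ((INR k + 1) * x - x) by ring.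
        rewrite cos_plus, cos_minus. field.
      * apply trig_poly_ext with (2 := trig_poly_lin (1/2) (-1/2) _ _
          (trig_poly_sin (S (S k))) (trig_poly_sin k)).
        intros x. rewrite !S_INR.
        replace ((INR k + 1 + 1) * x) with ((INR k + 1) * x + x) by ring.
        replace (INR k * x) with ((INR k + 1) * x - x) by ring.
        rewrite sin_plus, sin_minus. field.
  - destruct k as [|k].
    + split; apply trig_poly_ext with (2 := trig_poly_sin 0); intros x; simpl;
        rewrite Rmult_0_l, sin_0; ring.
    + split.
      * apply trig_poly_ext with (2 := trig_poly_lin (1/2) (1/2) _ _
          (trig_poly_sin (S (S k))) (trig_poly_sin k)).
        intros x. rewrite !S_INR.
        replace ((INR k + 1 + 1) * x) with ((INR k + 1) * x + x) by ring.
        replace (INR k * x) with ((INR k + 1) * x - x) by ring.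
        rewrite sin_plus, sin_minus. field.
      * apply trig_poly_ext with (2 := trig_poly_lin (-1/2) (1/2) _ _
          (trig_poly_cos (S (S k))) (trig_poly_cos k)).
        intros x. rewrite !S_INR.
        replace ((INR k + 1 + 1) * x) with ((INR k + 1) * x + x) by ring.
        replace (INR k * x) with ((INR k + 1) * x - x) by ring.
        rewrite cos_plus, cos_minus. field.
  - split.
    + apply trig_poly_ext with (2 := trig_poly_lin a b _ _ IHf IHg). intros; ring.
    + apply trig_poly_ext with (2 := trig_poly_lin a b _ _ IHf' IHg'). intros; ring.
  - split; [apply trig_poly_ext with (2 := IH)|apply trig_poly_ext with (2 := IH')];
      intros; now rewrite e.
Qed.

Lemma trig_poly_orthogonal (f : R -> R) : cont f ->
  (forall j, cint (fun x => f x * trig j x) = 0) ->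
  forall h, trig_poly h -> cont h /\ cint (fun x => f x * h x) = 0.
Proof.
  intros hf coef. induction 1 as [k|k|a b h1 h2 _ [c1 i1] _ [c2 i2]|h1 h2 e _ [c1 i1]].
  - split.
    + apply cont_ext with (trig (2 * k - 1)); [intros; apply trig_odd|apply cont_trig].
    + rewrite <- (coef (2 * k - 1)%nat). apply cint_ext. intros. now rewrite trig_odd.
  - destruct (Nat.eq_dec k 0) as [->|nz].
    + assert (z : forall x, 0 = sin (INR 0 * x)) by (intros; simpl; rewrite Rmult_0_l; now rewrite sin_0).
      split; [apply cont_ext with (1 := z), cont_const|].
      rewrite (cint_ext _ (fun _ => 0)) by (intros; rewrite <- z; ring).
      rewrite cint_const. ring.
    + split.
      * apply cont_ext with (trig (2 * k)); [intros; apply trig_even; lia|apply cont_trig].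
      * rewrite <- (coef (2 * k)%nat). apply cint_ext. intros. rewrite trig_even by lia. easy.
  - split; [now apply cont_lin|].
    rewrite (cint_ext _ (fun x => a * (f x * h1 x) + b * (f x * h2 x))) by (intros; ring).
    rewrite cint_lin, i1, i2 by now apply cont_mult. ring.
  - split; [now apply cont_ext with h1|].
    rewrite <- i1. apply cint_ext. intros; now rewrite e.
Qed.

Lemma cos_far (d y : R) : 0 <= d <= PI -> d <= Rabs y <= 2 * PI - d -> cos y <= cos d.
Proof.
  intros hd hy.
  assert (e : cos y = cos (Rabs y)).
  { unfold Rabs. destruct (Rcase_abs y); [now rewrite cos_neg|easy]. }
  rewrite e. destruct (Rle_dec (Rabs y) PI).
  - apply cos_decr_1; lra.
  - replace (cos (Rabs y)) with (cos (2 * PI - Rabs y)).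
    + apply cos_decr_1; lra.
    + rewrite cos_minus, cos_2PI, sin_2PI. ring.
Qed.

Lemma cos_near (d y : R) : d <= PI -> Rabs y < d -> cos d < cos y.
Proof.
  intros hd hy.
  assert (e : cos y = cos (Rabs y)).
  { unfold Rabs. destruct (Rcase_abs y); [now rewrite cos_neg|easy]. }
  rewrite e. assert (h := Rabs_pos y). apply cos_decreasing_1; lra.
Qed.

(** If [f x0 > 0], the powers of the trigonometric polynomial
    [1 + cos (x - x0) - cos d] concentrate near [x0]: they are bounded by [1] in
    absolute value at distance at least [d], and grow at least linearly in the
    exponent inside, which no vanishing integral against [f] allows. *)
Lemma fourier_not_pos (f : R -> R) (x0 : R) : cont f ->
  (forall j, cint (fun x => f x * trig j x) = 0) ->
  0 < x0 < 2 * PI -> ~ 0 < f x0.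
Proof.
  intros hf coef hx0 pos. assert (ppi := PI_RGT_0).
  destruct (cont_eps_delta f x0 (f x0 / 2) hf ltac:(lra)) as [d0 [dpos hd0]].
  (* Half the distance to the end points of the period also keeps the points far
     from [x0] away from [x0 - 2 * PI] and [x0 + 2 * PI]. *)
  set (d := Rmin (d0 / 2) (Rmin (x0 / 2) ((2 * PI - x0) / 2))).
  assert (hd : 0 < d /\ d < d0 /\ 2 * d <= x0 /\ 2 * d <= 2 * PI - x0).
  { unfold d. repeat split.
    - repeat apply Rmin_pos; lra.
    - apply Rle_lt_trans with (1 := Rmin_l _ _). lra.
    - apply Rle_trans with (2 * (x0 / 2)); [|lra].
      apply Rmult_le_compat_l; [lra|].
      apply Rle_trans with (1 := Rmin_r _ _). apply Rmin_l.
    - apply Rle_trans with (2 * ((2 * PI - x0) / 2)); [|lra].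
      apply Rmult_le_compat_l; [lra|].
      apply Rle_trans with (1 := Rmin_r _ _). apply Rmin_r. }
  clearbody d. destruct hd as [hd1 [hd2 [hd3 hd4]]].
  set (u := fun x => cos (x - x0) - cos d).
  set (gap := fun x => / 2 * Rabs (u x) + / 2 * u x).
  assert (cu : cont u).
  { apply cont_of_derive with (fun x => - sin (x - x0)). intros x. unfold u.
    auto_derive; [easy|]. unfold Rminus; ring. }
  assert (cgap : cont gap).
  { apply cont_lin; [|easy]. intros x. apply continuous_Rabs_comp, cu. }
  assert (near : forall x, Rabs (x - x0) < d -> 0 < u x /\ gap x = u x /\ f x0 / 2 <= f x).
  { intros x hx. assert (h := cos_near d (x - x0) ltac:(lra) hx).
    assert (0 < u x) by (unfold u; lra). split; [easy|]. split.
    - unfold gap. rewrite Rabs_pos_eq; lra.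
    - assert (h' := hd0 x ltac:(lra)).
      apply Rabs_def2 in h'. lra. }
  assert (far : forall x, 0 <= x <= 2 * PI -> ~ Rabs (x - x0) < d ->
             gap x = 0 /\ -1 <= 1 + u x <= 1).
  { intros x hx hx'. assert (h : cos (x - x0) <= cos d).
    { apply cos_far; [lra|]. split; [lra|]. apply Rabs_le. lra. }
    assert (u x <= 0) by (unfold u; lra). split.
    - unfold gap. rewrite Rabs_left1; lra.
    - unfold u. assert (b1 := COS_bound (x - x0)). assert (b2 := COS_bound d). lra. }
  assert (kernel : forall m, trig_poly (fun x => (1 + u x) ^ m)).
  { induction m as [|m IH].
    - apply trig_poly_ext with (2 := trig_poly_cos 0). intros x; simpl.
      now rewrite Rmult_0_l, cos_0.
    - destruct (trig_poly_mul_cos_sin _ IH) as [IHc IHs].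
      apply trig_poly_ext with (2 := trig_poly_lin 1 (1 - cos d) _ _
        (trig_poly_lin (cos x0) (sin x0) _ _ IHc IHs) IH).
      intros x. unfold u. simpl. rewrite cos_minus. ring. }
  destruct (continuity_ab_maj (fun x => Rabs (f x)) 0 (2 * PI)) as [xm [hxm _]]; [lra| |].
  { intros x _. apply continuity_pt_filterlim, continuous_Rabs_comp, hf. }
  set (F := Rabs (f xm)) in *. assert (Fpos : 0 <= F) by apply Rabs_pos.
  (* Bernoulli's inequality near [x0], a trivial bound elsewhere. *)
  assert (lower : forall m x, 0 <= x <= 2 * PI ->
    - F * 1 + f x0 / 2 * INR m * gap x <= f x * (1 + u x) ^ m).
  { intros m x hx. destruct (Rlt_dec (Rabs (x - x0)) d) as [h|h].
    - destruct (near x h) as [n1 [n2 n3]]. rewrite n2.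
      assert (b := poly m (u x) n1). assert (q : 0 <= INR m * u x)
        by (apply Rmult_le_pos; [apply pos_INR|lra]).
      apply Rle_trans with (f x0 / 2 * (1 + u x) ^ m).
      + assert (f x0 / 2 * (1 + INR m * u x) <= f x0 / 2 * (1 + u x) ^ m)
          by (apply Rmult_le_compat_l; lra). lra.
      + apply Rmult_le_compat_r; lra.
    - destruct (far x hx h) as [n1 n2]. rewrite n1.
      assert (b : Rabs (f x * (1 + u x) ^ m) <= F * 1).
      { rewrite Rabs_mult. apply Rmult_le_compat; try apply Rabs_pos; [now apply hxm|].
        rewrite <- RPow_abs. apply Rle_trans with (1 ^ m); [|rewrite pow1; lra].
        apply pow_incr. split; [apply Rabs_pos|]. apply Rabs_le. lra. }
      apply Rabs_le_between in b. lra. }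
  assert (Ipos : 0 < cint gap).
  { apply cint_pos with x0 d; try lra; [easy| |].
    - intros x hx. unfold gap. assert (h := Rle_abs (- u x)). rewrite Rabs_Ropp in h. lra.
    - intros x hx. assert (h : Rabs (x - x0) < d) by (apply Rabs_def1; lra).
      destruct (near x h) as [n1 [n2 _]]. lra. }
  destruct (INR_unbounded (F * (2 * PI) / (f x0 / 2 * cint gap))) as [m hm].
  destruct (trig_poly_orthogonal f hf coef _ (kernel m)) as [ck zero].
  assert (ineq := cint_le (fun x => - F * 1 + f x0 / 2 * INR m * gap x)
                 (fun x => f x * (1 + u x) ^ m)).
  rewrite zero, cint_lin, cint_const in ineq; [|apply cont_const|easy].
  specialize (ineq (cont_lin _ _ _ _ (cont_const 1) cgap) (cont_mult _ _ hf ck) (lower m)).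
  apply (Rmult_lt_compat_r (f x0 / 2 * cint gap)) in hm; [|apply Rmult_lt_0_compat; lra].
  replace (F * (2 * PI) / (f x0 / 2 * cint gap) * (f x0 / 2 * cint gap)) with (F * (2 * PI))
    in hm by (field; lra).
  lra.
Qed.

(** [fourier_not_pos] for [f] and [- f] gives the interior of the period; the end
    points follow by continuity. *)
Lemma fourier_complete (f : R -> R) : cont f -> (forall x, f (x + 2 * PI) = f x) ->
  (forall j, cint (fun x => f x * trig j x) = 0) -> forall x, f x = 0.
Proof.
  intros hf per coef. assert (ppi := PI_RGT_0).
  assert (inside : forall x, 0 < x < 2 * PI -> f x = 0).
  { intros x hx. assert (h1 := fourier_not_pos f x hf coef hx).
    assert (h2 : ~ 0 < -1 * f x).
    { apply (fourier_not_pos (fun x => -1 * f x)); [|  |easy].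
      - apply cont_mult; [apply cont_const|easy].
      - intros j. rewrite (cint_ext _ (fun x => -1 * (f x * trig j x))) by (intros; ring).
        rewrite cint_scal, coef by (apply cont_mult; [easy|apply cont_trig]). ring. }
    lra. }
  assert (at0 : f 0 = 0).
  { destruct (Req_dec (f 0) 0) as [|ne]; [easy|exfalso].
    assert (hp : 0 < Rabs (f 0)) by now apply Rabs_pos_lt.
    destruct (cont_eps_delta f 0 _ hf hp) as [d [dpos hd]].
    set (x := Rmin (d / 2) PI).
    assert (hx : 0 < x <= d / 2 /\ x <= PI).
    { unfold x. split; [split; [apply Rmin_pos; lra|apply Rmin_l]|apply Rmin_r]. }
    assert (h := hd x). rewrite inside in h by lra.
    rewrite Rminus_0_l, Rabs_Ropp in h.
    apply (Rlt_irrefl (Rabs (f 0))), h.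
    rewrite Rminus_0_r, Rabs_pos_eq; lra. }
  assert (wide : forall m x, - (2 * PI * INR m) <= x <= 2 * PI * (INR m + 1) -> f x = 0).
  { induction m as [|m IH]; intros x hx.
    - simpl in hx. destruct (Req_dec x 0) as [->|]; [easy|].
      destruct (Req_dec x (2 * PI)) as [->|]; [|apply inside; lra].
      rewrite <- (Rplus_0_l (2 * PI)), per. easy.
    - rewrite S_INR in hx. assert (h := pos_INR m).
      destruct (Rlt_dec x 0); [rewrite <- per; apply IH; nra|].
      replace x with (x - 2 * PI + 2 * PI) by ring. rewrite per.
      destruct (Rlt_dec (x - 2 * PI) 0); [rewrite <- per|]; apply IH; nra. }
  intros x. destruct (INR_unbounded (Rabs x)) as [m hm].
  assert (h := Rabs_def2 _ _ hm). assert (p := PI2_1). apply (wide m).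
  assert (h' := pos_INR m). split; nra.
Qed.

(** * Smooth functions on the cylinder and their Fourier coefficients *)

Lemma cont_sum (d : nat) (h : nat -> R -> R) :
  (forall i, cont (h i)) -> cont (fun x => sum_n_m (fun i => h i x) 1 d).
Proof.
  intros hh. induction d as [|d IH].
  - apply cont_ext with (fun _ => 0); [|apply cont_const].
    intros x. now rewrite sum_n_m_empty.
  - apply cont_ext with (fun x => 1 * sum_n_m (fun i => h i x) 1 d + 1 * h (S d) x).
    + intros x. rewrite sum_n_m_last. sum_ring.
    + now apply cont_lin.
Qed.

Lemma cint_sum (d : nat) (h : nat -> R -> R) : (forall i, cont (h i)) ->
  cint (fun x => sum_n_m (fun i => h i x) 1 d) = sum_n_m (fun i => cint (h i)) 1 d.
Proof.
  intros hh. induction d as [|d IH].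
  - rewrite (cint_ext _ (fun _ => 0)) by (intros; now rewrite sum_n_m_empty).
    rewrite cint_const, sum_n_m_empty. sum_ring.
  - rewrite (cint_ext _ (fun x => 1 * sum_n_m (fun i => h i x) 1 d + 1 * h (S d) x))
      by (intros; rewrite sum_n_m_last; sum_ring).
    rewrite cint_lin, IH, sum_n_m_last by (try apply cont_sum; easy). sum_ring.
Qed.

Lemma sum_n_m_only (a : nat -> R) (m d : nat) : (1 <= m <= d)%nat ->
  (forall i, (1 <= i <= d)%nat -> i <> m -> a i = 0) -> sum_n_m a 1 d = a m.
Proof.
  induction d as [|d IH]; intros hm ha; [lia|]. rewrite sum_n_m_last.
  destruct (Nat.eq_dec m (S d)) as [->|nm].
  - rewrite (sum_n_m_ext_loc a (fun _ => 0 * 0)).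
    + rewrite sum_n_m_scale. sum_ring.
    + intros k hk. rewrite ha by lia. sum_ring.
  - rewrite IH, (ha (S d)) by (intros; try apply ha; lia). sum_ring.
Qed.

Lemma sum_n_m_null (a : nat -> R) (d : nat) :
  (forall i, (1 <= i <= d)%nat -> a i = 0) -> sum_n_m a 1 d = 0.
Proof.
  intros ha. rewrite (sum_n_m_ext_loc a (fun _ => 0 * 0)).
  - rewrite sum_n_m_scale. sum_ring.
  - intros k hk. rewrite ha by lia. sum_ring.
Qed.

Definition smooth2 (u : R -> R -> R) : Prop := forall k t x, ex_diff_n u k t x.

Lemma smooth2_d_t (u : R -> R -> R) : smooth2 u -> smooth2 (d_t u).
Proof. intros h k t x. exact (proj1 (proj2 (proj2 (proj2 (h (S k) t x))))). Qed.

Lemma smooth2_d_th (u : R -> R -> R) : smooth2 u -> smooth2 (d_th u).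
Proof. intros h k t x. exact (proj2 (proj2 (proj2 (proj2 (h (S k) t x))))). Qed.

Lemma smooth2_is_derive_t (u : R -> R -> R) (t x : R) : smooth2 u ->
  is_derive (fun s => u s x) t (d_t u t x).
Proof. intros h. apply Derive_correct. exact (proj1 (proj2 (h 1%nat t x))). Qed.

Lemma smooth2_is_derive_th (u : R -> R -> R) (t x : R) : smooth2 u ->
  is_derive (fun y => u t y) x (d_th u t x).
Proof. intros h. apply Derive_correct. exact (proj1 (proj2 (proj2 (h 1%nat t x)))). Qed.

Lemma smooth2_cont (u : R -> R -> R) (t : R) : smooth2 u -> cont (u t).
Proof. intros h. apply cont_of_derive with (d_th u t). intros x. now apply smooth2_is_derive_th. Qed.

Lemma smooth2_continuity (u : R -> R -> R) (t x : R) : smooth2 u -> continuity_2d_pt u t x.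
Proof. intros h. exact (proj1 (h 0%nat t x)). Qed.

(** Products of solutions of linear second order equations: such a class is
    stable under both partial derivatives. *)
Lemma smooth2_product (c d : R) (k : nat) : forall (p p' q q' : R -> R),
  (forall t, is_derive p t (p' t)) -> (forall t, is_derive p' t (c * p t)) ->
  (forall x, is_derive q x (q' x)) -> (forall x, is_derive q' x (d * q x)) ->
  forall t x, ex_diff_n (fun t x => p t * q x) k t x.
Proof.
  induction k as [|k IH]; intros p p' q q' hp hp' hq hq' t x.
  all: assert (cont2 : continuity_2d_pt (fun t x => p t * q x) t x).
  1, 3: apply continuity_2d_pt_mult;
    [apply (continuity_1d_2d_pt_comp p (fun t _ => t)); [|apply continuity_2d_pt_id1]
    |apply (continuity_1d_2d_pt_comp q (fun _ x => x)); [|apply continuity_2d_pt_id2]];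
    apply continuity_pt_filterlim; [apply (cont_of_derive p p' hp)|apply (cont_of_derive q q' hq)].
  { split; [easy|exact I]. }
  assert (dt : forall t x, is_derive (fun t => p t * q x) t (p' t * q x)).
  { intros t0 x0. eapply is_derive_eq; [apply is_derive_mul; [apply hp|]|].
    - apply (is_derive_const (q x0)).
    - unfold zero; simpl; ring. }
  assert (dx : forall t x, is_derive (fun x => p t * q x) x (p t * q' x)).
  { intros t0 x0. eapply is_derive_eq; [apply is_derive_mul; [|apply hq]|].
    - apply (is_derive_const (p t0)).
    - unfold zero; simpl; ring. }
  split; [easy|]. split; [eexists; apply dt|]. split; [eexists; apply dx|].
  replace (fun u v => Derive (fun z => p z * q v) u) with (fun t x => p' t * q x)
    by (do 2 (apply functional_extensionality; intros); symmetry; apply is_derive_unique, dt).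
  replace (fun u v => Derive (fun z => p u * q z) v) with (fun t x => p t * q' x)
    by (do 2 (apply functional_extensionality; intros); symmetry; apply is_derive_unique, dx).
  split.
  - apply (IH p' (fun t => c * p t) q q'); try easy.
    intros s. apply is_derive_scal, hp.
  - apply (IH p p' q' (fun x => d * q x)); try easy.
    intros s. apply is_derive_scal, hq.
Qed.

Lemma smooth_of_second_order (c : R) (p p' : R -> R) :
  (forall t, is_derive p t (p' t)) -> (forall t, is_derive p' t (c * p t)) -> smooth p.
Proof.
  intros hp hp'.
  assert (form : forall k, exists a b, forall t, Derive_n p k t = a * p t + b * p' t).
  { induction k as [|k [a [b IH]]].
    - exists 1, 0. intros t. simpl. ring.
    - exists (b * c), a. intros t. simpl.
      rewrite (Derive_ext _ _ t IH). apply is_derive_unique.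
      eapply is_derive_eq; [apply (is_derive_plus (fun t => a * p t) (fun t => b * p' t));
        apply is_derive_scal; [apply hp|apply hp']|].
      unfold plus; simpl. ring. }
  intros k t. destruct k as [|k]; [exact I|]. simpl.
  destruct (form k) as [a [b h]]. apply ex_derive_ext with (fun t => a * p t + b * p' t).
  - intros s. now rewrite h.
  - eexists. apply (is_derive_plus (fun t => a * p t) (fun t => b * p' t));
      apply is_derive_scal; [apply hp|apply hp'].
Qed.

Definition coef (u : R -> R -> R) (j : nat) (t : R) : R := cint (fun x => u t x * trig j x).

Lemma is_derive_coef (u : R -> R -> R) (j : nat) (t : R) : smooth2 u ->
  is_derive (coef u j) t (coef (d_t u) j t).
Proof.
  intros hu.
  assert (dd : forall s x, is_derive (fun z => u z x * trig j x) s (d_t u s x * trig j x)).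
  { intros s x. eapply is_derive_eq; [apply is_derive_mul; [now apply smooth2_is_derive_t|]|].
    - apply (is_derive_const (trig j x)).
    - unfold zero; simpl; ring. }
  eapply is_derive_eq.
  - apply (is_derive_RInt_param (fun t x => u t x * trig j x) 0 (2 * PI)).
    + apply filter_forall. intros s x _. eexists. apply dd.
    + intros x _. apply continuity_2d_pt_ext with (fun s x => d_t u s x * trig j x).
      * intros s y. symmetry. apply is_derive_unique, dd.
      * apply continuity_2d_pt_mult; [now apply smooth2_continuity, smooth2_d_t|].
        apply (continuity_1d_2d_pt_comp (trig j) (fun _ x => x)); [|apply continuity_2d_pt_id2].
        apply continuity_pt_filterlim, cont_trig.
    + apply filter_forall. intros s. apply cont_ex_RInt, cont_mult; [|apply cont_trig].
      now apply smooth2_cont.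
  - apply cint_ext. intros x. apply is_derive_unique, dd.
Qed.

Lemma d_th_period (u : R -> R -> R) (t : R) : smooth2 u ->
  (forall x, u t (x + 2 * PI) = u t x) -> forall x, d_th u t (x + 2 * PI) = d_th u t x.
Proof.
  intros hu per x. symmetry. apply is_derive_unique.
  apply is_derive_ext with (fun x => u t (x + 2 * PI)); [easy|].
  eapply is_derive_eq.
  - apply (is_derive_comp (fun y => u t y) (fun x => x + 2 * PI)).
    + now apply smooth2_is_derive_th.
    + auto_derive; [easy|reflexivity].
  - unfold scal; simpl; unfold mult; simpl. ring.
Qed.

(** Two integrations by parts. *)
Lemma coef_d_th_d_th (u : R -> R -> R) (j : nat) (t : R) : smooth2 u ->
  (forall x, u t (x + 2 * PI) = u t x) ->
  coef (d_th (d_th u)) j t = - INR (freq j) ^ 2 * coef u j t.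
Proof.
  intros hu per. unfold coef.
  assert (hu' := smooth2_d_th u hu). assert (hu'' := smooth2_d_th _ hu').
  assert (c1 : cont (fun x => u t x * trig j x))
    by (apply cont_mult; [now apply smooth2_cont|apply cont_trig]).
  assert (c2 : cont (fun x => d_th (d_th u) t x * trig j x))
    by (apply cont_mult; [now apply smooth2_cont|apply cont_trig]).
  assert (zero : cint (fun x => 1 * (d_th (d_th u) t x * trig j x)
                    + INR (freq j) ^ 2 * (u t x * trig j x)) = 0).
  { rewrite (cint_derive (fun x => d_th u t x * trig j x - u t x * trig' j x)).
    - assert (e1 := per 0). assert (e2 := d_th_period u t hu per 0).
      assert (e3 := trig_period j 0). assert (e4 := trig'_period j 0).
      rewrite Rplus_0_l in e1, e2, e3, e4. rewrite e1, e2, e3, e4. ring.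
    - intros x. eapply is_derive_eq.
      + apply (is_derive_minus (fun x => d_th u t x * trig j x) (fun x => u t x * trig' j x));
          apply is_derive_mul.
        * now apply (smooth2_is_derive_th (d_th u)).
        * apply is_derive_trig.
        * now apply smooth2_is_derive_th.
        * apply is_derive_trig'.
      + unfold minus, plus, opp; simpl. ring.
    - now apply cont_lin. }
  rewrite cint_lin in zero by easy. lra.
Qed.

(** * Separation of variables *)

Section Separation.
Variable T : R.
Hypothesis hT : 0 < T.

Definition left_profile (k : nat) (t : R) : R :=
  if Nat.eqb k 0 then (T - t) / T else sinh (INR k * (T - t)) / sinh (INR k * T).
Definition left_profile' (k : nat) (t : R) : R :=
  if Nat.eqb k 0 then - / T else - (INR k * cosh (INR k * (T - t)) / sinh (INR k * T)).
Definition right_profile (k : nat) (t : R) : R :=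
  if Nat.eqb k 0 then t / T else sinh (INR k * t) / sinh (INR k * T).
Definition right_profile' (k : nat) (t : R) : R :=
  if Nat.eqb k 0 then / T else INR k * cosh (INR k * t) / sinh (INR k * T).

(** Entries of the Dirichlet-to-Neumann matrix in frequency [k]. *)
Definition dn_diag (k : nat) : R := ycoth (INR k * T) / T.
Definition dn_off (k : nat) : R :=
  if Nat.eqb k 0 then / T else INR k / sinh (INR k * T).

Lemma freq_height_pos (k : nat) : k <> 0%nat -> 0 < INR k /\ 0 < INR k * T /\ 0 < sinh (INR k * T).
Proof.
  intros nz. assert (0 < INR k) by (apply lt_0_INR; lia).
  assert (0 < INR k * T) by nra. assert (h := sinh_pos _ H0). easy.
Qed.

Lemma is_derive_left_profile k t : is_derive (left_profile k) t (left_profile' k t).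
Proof.
  unfold left_profile, left_profile'. destruct (Nat.eqb_spec k 0) as [e|e].
  - auto_derive; [lra|]. field. lra.
  - destruct (freq_height_pos k e) as [h1 [h2 h3]]. auto_derive; [lra|].
    unfold Rminus. field. lra.
Qed.

Lemma is_derive_left_profile' k t :
  is_derive (left_profile' k) t (INR k ^ 2 * left_profile k t).
Proof.
  unfold left_profile, left_profile'. destruct (Nat.eqb_spec k 0) as [e|e].
  - subst. auto_derive; [easy|]. simpl. ring.
  - destruct (freq_height_pos k e) as [h1 [h2 h3]]. auto_derive; [lra|].
    unfold Rminus. field. lra.
Qed.

Lemma is_derive_right_profile k t : is_derive (right_profile k) t (right_profile' k t).
Proof.
  unfold right_profile, right_profile'. destruct (Nat.eqb_spec k 0) as [e|e].
  - auto_derive; [lra|]. field. lra.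
  - destruct (freq_height_pos k e) as [h1 [h2 h3]]. auto_derive; [lra|]. field. lra.
Qed.

Lemma is_derive_right_profile' k t :
  is_derive (right_profile' k) t (INR k ^ 2 * right_profile k t).
Proof.
  unfold right_profile, right_profile'. destruct (Nat.eqb_spec k 0) as [e|e].
  - subst. auto_derive; [easy|]. simpl. ring.
  - destruct (freq_height_pos k e) as [h1 [h2 h3]]. auto_derive; [lra|]. field. lra.
Qed.

Lemma dn_diag_0 : dn_diag 0 = / T.
Proof. unfold dn_diag. simpl. rewrite Rmult_0_l, ycoth_0. field. lra. Qed.

Lemma dn_diag_pos_freq k : k <> 0%nat ->
  dn_diag k = INR k * cosh (INR k * T) / sinh (INR k * T).
Proof.
  intros e. destruct (freq_height_pos k e) as [h1 [h2 h3]].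
  unfold dn_diag. rewrite ycoth_pos by easy. unfold coth. field. lra.
Qed.

Lemma left_profile_ends k : left_profile k 0 = 1 /\ left_profile k T = 0 /\
  left_profile' k 0 = - dn_diag k /\ left_profile' k T = - dn_off k.
Proof.
  unfold left_profile, left_profile', dn_off. destruct (Nat.eqb_spec k 0) as [->|e].
  - rewrite dn_diag_0. repeat split; field; lra.
  - destruct (freq_height_pos k e) as [h1 [h2 h3]]. rewrite dn_diag_pos_freq by easy.
    rewrite Rminus_0_r. replace (T - T) with 0 by ring.
    rewrite Rmult_0_r, sinh_0, cosh_0. repeat split; field; lra.
Qed.

Lemma right_profile_ends k : right_profile k 0 = 0 /\ right_profile k T = 1 /\
  right_profile' k 0 = dn_off k /\ right_profile' k T = dn_diag k.
Proof.
  unfold right_profile, right_profile', dn_off. destruct (Nat.eqb_spec k 0) as [->|e].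
  - rewrite dn_diag_0. repeat split; field; lra.
  - destruct (freq_height_pos k e) as [h1 [h2 h3]]. rewrite dn_diag_pos_freq by easy.
    rewrite Rmult_0_r, sinh_0, cosh_0. repeat split; field; lra.
Qed.

Lemma dn_off_pos k : 0 < dn_off k.
Proof.
  unfold dn_off. destruct (Nat.eqb_spec k 0) as [e|e].
  - now apply Rinv_0_lt_compat.
  - destruct (freq_height_pos k e) as [h1 [h2 h3]]. now apply Rdiv_lt_0_compat.
Qed.

Lemma dn_diag_pos k : 0 < dn_diag k.
Proof.
  unfold dn_diag. apply Rdiv_lt_0_compat; [|easy].
  assert (h := pos_INR k). assert (h' := ycoth_ge_1 (INR k * T) ltac:(nra)). lra.
Qed.

Lemma dn_diag_sqr k : dn_diag k ^ 2 = dn_off k ^ 2 + INR k ^ 2.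
Proof.
  unfold dn_off. destruct (Nat.eqb_spec k 0) as [->|e].
  - rewrite dn_diag_0. simpl. ring.
  - destruct (freq_height_pos k e) as [h1 [h2 h3]]. rewrite dn_diag_pos_freq by easy.
    transitivity (INR k ^ 2 * cosh (INR k * T) ^ 2 / sinh (INR k * T) ^ 2); [field; lra|].
    rewrite cosh_sqr. field. lra.
Qed.

(** The Wronskian of two solutions is constant; [p] is only known to solve the
    equation inside, and the ends are reached by continuity. *)
Lemma wronskian_ends (c : R) (p p1 p2 v v1 : R -> R) :
  (forall t, is_derive p t (p1 t)) -> (forall t, is_derive p1 t (p2 t)) ->
  (forall t, 0 < t < T -> p2 t = c * p t) ->
  (forall t, is_derive v t (v1 t)) -> (forall t, is_derive v1 t (c * v t)) ->
  p1 T * v T - p T * v1 T = p1 0 * v 0 - p 0 * v1 0.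
Proof.
  intros hp hp1 ode hv hv1.
  assert (d : forall t, is_derive (fun t => p1 t * v t - p t * v1 t) t
                          (p2 t * v t - p t * (c * v t))).
  { intros t. eapply is_derive_eq.
    - apply (is_derive_minus (fun t => p1 t * v t) (fun t => p t * v1 t)).
      + apply is_derive_mul; [apply hp1|apply hv].
      + apply is_derive_mul; [apply hp|apply hv1].
    - unfold minus, plus, opp; simpl. ring. }
  destruct (MVT_gen (fun t => p1 t * v t - p t * v1 t) 0 T (fun _ => 0)) as [t [_ e]].
  - intros t ht. rewrite Rmin_left, Rmax_right in ht by lra.
    eapply is_derive_eq; [apply d|]. rewrite ode by easy. ring.
  - intros t _. apply continuity_pt_filterlim. apply (cont_of_derive _ _ d).
  - lra.
Qed.

(** Green's formula against the two profiles gives the boundary derivatives of a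
    solution without solving the equation. *)
Lemma dn_matrix (k : nat) (p p1 p2 : R -> R) :
  (forall t, is_derive p t (p1 t)) -> (forall t, is_derive p1 t (p2 t)) ->
  (forall t, 0 < t < T -> p2 t = INR k ^ 2 * p t) ->
  - p1 0 = dn_diag k * p 0 - dn_off k * p T /\
  p1 T = dn_diag k * p T - dn_off k * p 0.
Proof.
  intros hp hp1 ode.
  assert (l := wronskian_ends _ p p1 p2 _ _ hp hp1 ode
                 (is_derive_left_profile k) (is_derive_left_profile' k)).
  assert (r := wronskian_ends _ p p1 p2 _ _ hp hp1 ode
                 (is_derive_right_profile k) (is_derive_right_profile' k)).
  destruct (left_profile_ends k) as [e1 [e2 [e3 e4]]].
  destruct (right_profile_ends k) as [e5 [e6 [e7 e8]]].
  rewrite e1, e2, e3, e4 in l. rewrite e5, e6, e7, e8 in r. lra.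
Qed.

(** * The Steklov spectrum of a rotationally symmetric cylinder *)

Variables al be : R.
Hypothesis hal : 0 < al.
Hypothesis hbe : 0 < be.

Definition charpoly (k : nat) (s : R) : R :=
  al * be * s ^ 2 - dn_diag k * (al + be) * s + INR k ^ 2.

Definition discr (k : nat) : R := (dn_diag k * (al + be)) ^ 2 - 4 * (al * be) * INR k ^ 2.

Definition low_root (k : nat) : R :=
  (dn_diag k * (al + be) - sqrt (discr k)) / (2 * (al * be)).
Definition high_root (k : nat) : R :=
  (dn_diag k * (al + be) + sqrt (discr k)) / (2 * (al * be)).

Lemma discr_pos k : 0 < discr k.
Proof.
  assert (e : discr k = INR k ^ 2 * (al - be) ^ 2 + (dn_off k * (al + be)) ^ 2).
  { unfold discr. rewrite Rpow_mult_distr, dn_diag_sqr. ring. }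
  assert (h := dn_off_pos k). assert (0 < dn_off k * (al + be)) by nra.
  assert (0 <= (INR k * (al - be)) ^ 2) by apply pow2_ge_0.
  rewrite e, <- Rpow_mult_distr.
  assert (0 < (dn_off k * (al + be)) ^ 2) by now apply pow_lt. lra.
Qed.

Lemma charpoly_factor k s :
  charpoly k s = al * be * ((s - low_root k) * (s - high_root k)).
Proof.
  assert (h := sqrt_sqrt (discr k) (Rlt_le _ _ (discr_pos k))).
  unfold low_root, high_root. set (D := sqrt (discr k)) in *.
  transitivity (al * be * s ^ 2 - dn_diag k * (al + be) * s
    + ((dn_diag k * (al + be)) ^ 2 - D * D) / (4 * (al * be))); [|field; lra].
  rewrite h. unfold charpoly, discr. field. lra.
Qed.

Lemma low_lt_high k : low_root k < high_root k.
Proof.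
  unfold low_root, high_root. assert (h := sqrt_lt_R0 _ (discr_pos k)).
  apply Rmult_lt_compat_r; [apply Rinv_0_lt_compat; nra|lra].
Qed.

Lemma root_product k : al * be * (low_root k * high_root k) = INR k ^ 2.
Proof.
  transitivity (al * be * ((0 - low_root k) * (0 - high_root k))); [ring|].
  rewrite <- charpoly_factor. unfold charpoly. ring.
Qed.

Lemma root_sum k : al * be * (low_root k + high_root k) = dn_diag k * (al + be).
Proof. unfold low_root, high_root. field. lra. Qed.

Lemma high_root_pos k : 0 < high_root k.
Proof.
  unfold high_root. assert (h := sqrt_lt_R0 _ (discr_pos k)). assert (h' := dn_diag_pos k).
  apply Rdiv_lt_0_compat; nra.
Qed.

Lemma low_root_nonneg k : 0 <= low_root k.
Proof.
  assert (h := root_product k). assert (h' := high_root_pos k). assert (h'' := pos_INR k).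
  destruct (Rle_dec 0 (low_root k)); [easy|exfalso].
  assert (low_root k * high_root k < 0) by nra. assert (0 < al * be) by nra. nra.
Qed.

Lemma charpoly_zero k s : charpoly k s = 0 <-> s = low_root k \/ s = high_root k.
Proof.
  rewrite charpoly_factor. split.
  - intros h. apply Rmult_integral in h. destruct h as [h|h]; [nra|].
    apply Rmult_integral in h. destruct h; [left|right]; lra.
  - intros [->| ->]; ring.
Qed.

(** The product of the roots is of order [k^2] and the larger root at most of
    order [k]. *)
Lemma low_root_grows k : INR k * (/ ((1 + / T) * (al + be))) <= low_root k.
Proof.
  destruct (Nat.eq_dec k 0) as [->|nz].
  { simpl. rewrite Rmult_0_l. apply low_root_nonneg. }
  destruct (freq_height_pos k nz) as [h1 [h2 _]].
  assert (k1 : 1 <= INR k) by (apply (le_INR 1); lia).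
  assert (iT := Rinv_0_lt_compat T hT).
  assert (hk : dn_diag k <= INR k * (1 + / T)).
  { unfold dn_diag. assert (b := ycoth_le (INR k * T) ltac:(lra)).
    apply Rle_trans with ((1 + INR k * T) / T).
    - apply Rmult_le_compat_r; lra.
    - replace ((1 + INR k * T) / T) with (INR k + / T) by (field; lra). nra. }
  assert (lp := low_root_nonneg k). assert (hp := high_root_pos k).
  assert (pr := root_product k). assert (sm := root_sum k).
  assert (pp : 0 < al * be) by nra.
  assert (up : al * be * high_root k <= INR k * (1 + / T) * (al + be)).
  { assert (dn_diag k * (al + be) <= INR k * (1 + / T) * (al + be))
      by (apply Rmult_le_compat_r; lra). nra. }
  assert (q : 0 < (1 + / T) * (al + be)) by (apply Rmult_lt_0_compat; lra).
  apply Rmult_le_reg_r with ((1 + / T) * (al + be)); [easy|].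
  rewrite Rmult_assoc, Rinv_l, Rmult_1_r by lra.
  apply Rmult_le_reg_l with (INR k); [easy|].
  replace (INR k * INR k) with (low_root k * (al * be * high_root k)) by (rewrite <- (Rmult_1_r (INR k * INR k)); nra).
  replace (INR k * (low_root k * ((1 + / T) * (al + be))))
    with (low_root k * (INR k * (1 + / T) * (al + be))) by ring.
  now apply Rmult_le_compat_l.
Qed.

(** The Fourier mode [trig j] carries the eigenvalues of indices [2 j] and [2 j + 1]. *)
Definition eigenvalue (i : nat) : R :=
  if Nat.even i then low_root (freq (Nat.div2 i)) else high_root (freq (Nat.div2 i)).

Lemma eigenvalue_even j : eigenvalue (2 * j) = low_root (freq j).
Proof.
  unfold eigenvalue. rewrite Nat.even_mul, Nat.div2_double. easy.
Qed.

Lemma eigenvalue_odd j : eigenvalue (S (2 * j)) = high_root (freq j).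
Proof.
  unfold eigenvalue. rewrite Nat.even_succ, Nat.odd_mul, Nat.div2_succ_double. easy.
Qed.

Lemma index_cases i : (i = 2 * Nat.div2 i \/ i = S (2 * Nat.div2 i))%nat.
Proof. assert (h := Nat.div2_odd i). destruct (Nat.odd i); simpl in h; lia. Qed.

Lemma charpoly_eigenvalue i : charpoly (freq (Nat.div2 i)) (eigenvalue i) = 0.
Proof. apply charpoly_zero. unfold eigenvalue. destruct (Nat.even i); auto. Qed.

Lemma eigenvalue_inj i i' : Nat.div2 i = Nat.div2 i' -> eigenvalue i = eigenvalue i' -> i = i'.
Proof.
  intros e ev. assert (h := low_lt_high (freq (Nat.div2 i'))).
  destruct (index_cases i) as [hi|hi], (index_cases i') as [hi'|hi']; try lia;
    rewrite hi, hi', e, ?eigenvalue_even, ?eigenvalue_odd in ev; lra.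
Qed.

Lemma eigenvalue_proper M : exists N, forall i, eigenvalue i <= M -> (i < N)%nat.
Proof.
  set (c := / ((1 + / T) * (al + be))).
  assert (cpos : 0 < c).
  { assert (iT := Rinv_0_lt_compat T hT). apply Rinv_0_lt_compat, Rmult_lt_0_compat; lra. }
  destruct (INR_unbounded (M / c)) as [K hK].
  exists (4 * K)%nat. intros i hi.
  assert (h : low_root (freq (Nat.div2 i)) <= M).
  { unfold eigenvalue in hi. assert (l := low_lt_high (freq (Nat.div2 i))).
    destruct (Nat.even i); lra. }
  assert (g := low_root_grows (freq (Nat.div2 i))). fold c in g.
  assert (lt : INR (freq (Nat.div2 i)) < INR K).
  { apply Rle_lt_trans with (2 := hK). apply Rmult_le_reg_r with c; [easy|].
    replace (M / c * c) with M by (field; lra). lra. }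
  apply INR_lt in lt.
  destruct (freq_cases (Nat.div2 i)); destruct (index_cases i); lia.
Qed.

(** The vector solves the first row of the boundary eigenvalue problem for every
    [s]; the second row then holds exactly when [charpoly k s = 0]. *)
Definition mode_value (k : nat) (s : R) (e : bd_component) : R :=
  match e with Bottom => dn_off k | Top => dn_diag k - s * al end.

Definition mode (s : R) (j : nat) : bd_fun :=
  fun e x => mode_value (freq j) s e * trig j x.

Definition mode_extension (s : R) (j : nat) (t x : R) : R :=
  (dn_off (freq j) * left_profile (freq j) t
   + (dn_diag (freq j) - s * al) * right_profile (freq j) t) * trig j x.

Section Metric.
Variables (g : metric) (f : R -> R).
Hypothesis f_pos : forall t, 0 <= t <= T -> 0 < f t.
Hypothesis f_metric : forall t x, 0 <= t <= T ->
  g_tt g t x = f t ^ 2 /\ g_th g t x = 0 /\ g_hh g t x = f t ^ 2.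
Hypothesis f_bottom : f 0 = al.
Hypothesis f_top : f T = be.

Lemma det_conformal t x : 0 <= t <= T -> det_g g t x = f t ^ 4.
Proof. intros h. unfold det_g. destruct (f_metric t x h) as [-> [-> ->]]. ring. Qed.

Lemma sqrt_det_conformal t x : 0 <= t <= T -> sqrt (det_g g t x) = f t ^ 2.
Proof.
  intros h. rewrite det_conformal by easy. replace (f t ^ 4) with ((f t ^ 2) ^ 2) by ring.
  apply sqrt_pow2. assert (h' := f_pos t h). nra.
Qed.

Lemma grad_conformal u t x : 0 <= t <= T ->
  grad_t g u t x = d_t u t x / f t ^ 2 /\ grad_th g u t x = d_th u t x / f t ^ 2.
Proof.
  intros h. unfold grad_t, grad_th, ginv_tt, ginv_th, ginv_hh.
  rewrite det_conformal by easy. destruct (f_metric t x h) as [-> [-> ->]].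
  assert (h' := f_pos t h). split; field; lra.
Qed.

Lemma laplacian_conformal u t x : 0 < t < T ->
  laplacian g u t x = / f t ^ 2 * (d_t (d_t u) t x + d_th (d_th u) t x).
Proof.
  intros h. unfold laplacian. rewrite sqrt_det_conformal by lra. f_equal. f_equal.
  - unfold d_t at 1 3. apply Derive_ext_loc.
    assert (hd : 0 < Rmin t (T - t)) by (apply Rmin_pos; lra).
    exists (mkposreal _ hd). intros s hs.
    assert (hs' : Rabs (s - t) < Rmin t (T - t)) by exact hs.
    assert (l1 := Rmin_l t (T - t)). assert (l2 := Rmin_r t (T - t)).
    apply Rabs_def2 in hs'.
    rewrite sqrt_det_conformal, (proj1 (grad_conformal u s x ltac:(lra))) by lra.
    assert (p := f_pos s ltac:(lra)). change (f s ^ 2 * (d_t u s x / f s ^ 2) = d_t u s x).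
    field. lra.
  - unfold d_th at 1 3. apply Derive_ext. intros y.
    rewrite sqrt_det_conformal, (proj2 (grad_conformal u t y ltac:(lra))) by lra.
    assert (p := f_pos t ltac:(lra)). change (f t ^ 2 * (d_th u t y / f t ^ 2) = d_th u t y).
    field. lra.
Qed.

Lemma harmonic_conformal u : harmonic T g u <->
  forall t x, 0 < t < T -> d_t (d_t u) t x + d_th (d_th u) t x = 0.
Proof.
  unfold harmonic. split; intros h t x ht; specialize (h t x ht);
    rewrite laplacian_conformal in * by easy; assert (p := f_pos t ltac:(lra)).
  - apply Rmult_integral in h. destruct h as [h|h]; [|easy].
    assert (0 < / f t ^ 2) by (apply Rinv_0_lt_compat; nra). lra.
  - rewrite h. ring.
Qed.

Lemma normal_derivative_conformal u x :
  normal_derivative T g u Bottom x = - d_t u 0 x / al /\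
  normal_derivative T g u Top x = d_t u T x / be.
Proof.
  assert (s : forall t, 0 <= t <= T -> sqrt (ginv_tt g t x) = / f t).
  { intros t h. unfold ginv_tt. rewrite det_conformal by easy.
    destruct (f_metric t x h) as [_ [_ ->]]. assert (h' := f_pos t h).
    replace (f t ^ 2 / f t ^ 4) with ((/ f t) ^ 2) by (field; lra).
    apply sqrt_pow2. left. now apply Rinv_0_lt_compat. }
  unfold normal_derivative, bd_sign, bd_pos.
  rewrite !s, (proj1 (grad_conformal u 0 x ltac:(lra))),
    (proj1 (grad_conformal u T x ltac:(lra))) by lra.
  rewrite f_bottom, f_top. split; field; lra.
Qed.

Lemma boundary_length_conformal : boundary_length T g = 2 * PI * (al + be).
Proof.
  assert (s : forall t, 0 <= t <= T -> RInt (fun x => sqrt (g_hh g t x)) 0 (2 * PI) = 2 * PI * f t).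
  { intros t h. rewrite <- cint_const. apply RInt_ext. intros x _.
    destruct (f_metric t x h) as [_ [_ ->]]. apply sqrt_pow2. left. now apply f_pos. }
  unfold boundary_length. rewrite !s, f_bottom, f_top by lra. ring.
Qed.

Lemma mode_in_eigenspace s j : charpoly (freq j) s = 0 ->
  steklov_eigenspace T g s (mode s j).
Proof.
  intros root. set (k := freq j) in *.
  set (A := dn_off k). set (B := dn_diag k - s * al).
  set (p := fun t => A * left_profile k t + B * right_profile k t).
  set (p' := fun t => A * left_profile' k t + B * right_profile' k t).
  assert (hp : forall t, is_derive p t (p' t)).
  { intros t. apply (is_derive_plus (fun t => A * left_profile k t) (fun t => B * right_profile k t));
      apply is_derive_scal; [apply is_derive_left_profile|apply is_derive_right_profile]. }
  assert (hp' : forall t, is_derive p' t (INR k ^ 2 * p t)).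
  { intros t. eapply is_derive_eq.
    - apply (is_derive_plus (fun t => A * left_profile' k t) (fun t => B * right_profile' k t));
        apply is_derive_scal; [apply is_derive_left_profile'|apply is_derive_right_profile'].
    - unfold plus, p; simpl. ring. }
  assert (dt : forall (q q' : R -> R), (forall t, is_derive q t (q' t)) ->
    forall t x, is_derive (fun t => q t * trig j x) t (q' t * trig j x)).
  { intros q q' hq t x. eapply is_derive_eq; [apply is_derive_mul; [apply hq|]|].
    - apply (is_derive_const (trig j x)).
    - unfold zero; simpl; ring. }
  assert (e1 : d_t (mode_extension s j) = fun t x => p' t * trig j x).
  { do 2 (apply functional_extensionality; intros). apply is_derive_unique.
    apply (dt p p' hp). }
  assert (e2 : d_t (d_t (mode_extension s j)) = fun t x => INR k ^ 2 * p t * trig j x).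
  { rewrite e1. do 2 (apply functional_extensionality; intros). apply is_derive_unique.
    apply (dt p' (fun t => INR k ^ 2 * p t) hp'). }
  assert (e3 : d_th (mode_extension s j) = fun t x => p t * trig' j x).
  { do 2 (apply functional_extensionality; intros). apply is_derive_unique.
    apply is_derive_scal, is_derive_trig. }
  assert (e4 : d_th (d_th (mode_extension s j)) = fun t x => p t * (- INR k ^ 2 * trig j x)).
  { rewrite e3. do 2 (apply functional_extensionality; intros). apply is_derive_unique.
    apply is_derive_scal, is_derive_trig'. }
  destruct (left_profile_ends k) as [l1 [l2 [l3 l4]]].
  destruct (right_profile_ends k) as [r1 [r2 [r3 r4]]].
  split.
  - intros e. split.
    + apply smooth_of_second_order with (c := - INR k ^ 2)
        (p' := fun x => mode_value k s e * trig' j x).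
      * intros x. apply is_derive_scal, is_derive_trig.
      * intros x. eapply is_derive_eq; [apply is_derive_scal, is_derive_trig'|].
        unfold mode. fold k. simpl. ring.
    + intros x. unfold mode. now rewrite trig_period.
  - exists (mode_extension s j). split; [split|split; [|split]].
    + intros m t x. apply (smooth2_product (INR k ^ 2) (- INR k ^ 2) m p p' (trig j) (trig' j));
        [easy|easy|apply is_derive_trig|apply is_derive_trig'].
    + intros t x. unfold mode_extension. now rewrite trig_period.
    + apply harmonic_conformal. intros t x _. rewrite e2, e4. ring.
    + intros e x. unfold mode_extension, mode, mode_value, bd_pos. fold k.
      destruct e; rewrite ?l1, ?l2, ?r1, ?r2; ring.
    + intros e x; unfold mode, mode_value; fold k.
      destruct (normal_derivative_conformal (mode_extension s j) x) as [nb nt].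
      destruct e; rewrite ?nb, ?nt, e1; unfold p', A, B; rewrite ?l3, ?r3, ?l4, ?r4.
      * field. lra.
      * assert (key : - dn_off k * dn_off k + (dn_diag k - s * al) * dn_diag k
                  = be * (s * (dn_diag k - s * al))).
        { assert (q := dn_diag_sqr k). unfold charpoly in root. nra. }
        replace (dn_off k * - dn_off k + (dn_diag k - s * al) * dn_diag k)
          with (be * (s * (dn_diag k - s * al))) by lra. field. lra.
Qed.

Lemma eigenfunction_coefficients s phi : steklov_eigenspace T g s phi ->
  forall j, let A := cint (fun x => phi Bottom x * trig j x) in
            let B := cint (fun x => phi Top x * trig j x) in
    s * al * A = dn_diag (freq j) * A - dn_off (freq j) * B /\
    s * be * B = dn_diag (freq j) * B - dn_off (freq j) * A.
Proof.
  intros [smooth_phi [u [[hu per] [harm [bd nd]]]]] j A B.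
  change (smooth2 u) in hu.
  assert (bd0 : forall x, u 0 x = phi Bottom x) by exact (bd Bottom).
  assert (bdT : forall x, u T x = phi Top x) by exact (bd Top).
  assert (hu1 := smooth2_d_t u hu). assert (hu2 := smooth2_d_t _ hu1).
  assert (hth := smooth2_d_th _ (smooth2_d_th u hu)).
  assert (cc : forall v t, smooth2 v -> cont (fun x => v t x * trig j x)).
  { intros v t hv. apply cont_mult; [now apply smooth2_cont|apply cont_trig]. }
  destruct (dn_matrix (freq j) (coef u j) (coef (d_t u) j) (coef (d_t (d_t u)) j)) as [m0 mT].
  - intros t. now apply is_derive_coef.
  - intros t. now apply is_derive_coef.
  - intros t ht. apply Rplus_eq_reg_r with (- INR (freq j) ^ 2 * coef u j t).
    rewrite <- coef_d_th_d_th at 1 by auto.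
    unfold coef at 1 2.
    assert (z := cint_lin 1 1 _ _ (cc (d_t (d_t u)) t hu2) (cc _ t hth)).
    rewrite (cint_ext _ (fun _ => 0)), cint_const in z.
    + unfold coef. unfold coef in z. lra.
    + intros x. assert (h := proj1 (harmonic_conformal u) harm t x ht).
      replace (d_t (d_t u) t x) with (- d_th (d_th u) t x) by lra. ring.
  - assert (eA : coef u j 0 = A) by (apply cint_ext; intros x; now rewrite bd0).
    assert (eB : coef u j T = B) by (apply cint_ext; intros x; now rewrite bdT).
    rewrite eA, eB in m0, mT. rewrite <- m0, <- mT. split.
    + unfold A. rewrite <- cint_scal by (apply (cont_ext (fun x => u 0 x * trig j x));
        [intros x; now rewrite bd0|now apply cc]).
      replace (- coef (d_t u) j 0) with (-1 * coef (d_t u) j 0) by ring.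
      unfold coef. rewrite <- cint_scal by now apply cc.
      apply cint_ext. intros x. assert (h := nd Bottom x).
      rewrite (proj1 (normal_derivative_conformal u x)) in h.
      replace (s * al * (phi Bottom x * trig j x)) with (s * phi Bottom x * al * trig j x) by ring.
      rewrite <- h. field. lra.
    + unfold B. rewrite <- cint_scal by (apply (cont_ext (fun x => u T x * trig j x));
        [intros x; now rewrite bdT|now apply cc]).
      apply cint_ext. intros x. assert (h := nd Top x).
      rewrite (proj2 (normal_derivative_conformal u x)) in h.
      replace (s * be * (phi Top x * trig j x)) with (s * phi Top x * be * trig j x) by ring.
      rewrite <- h. field. lra.
Qed.

Lemma coef_lin_comb d c s (js : nat -> nat) e j :
  cint (fun x => lin_comb d c (fun m => mode s (js m)) e x * trig j x) =
  sum_n_m (fun m => c m * mode_value (freq (js m)) s e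
                    * cint (fun x => trig (js m) x * trig j x)) 1 d.
Proof.
  rewrite (cint_ext _ (fun x => sum_n_m (fun m =>
    c m * mode_value (freq (js m)) s e * (trig (js m) x * trig j x)) 1 d)).
  - rewrite (cint_sum d (fun m x => c m * mode_value (freq (js m)) s e * (trig (js m) x * trig j x))).
    + apply sum_n_m_ext. intros m. rewrite cint_scal; [easy|].
      apply cont_mult; apply cont_trig.
    + intros m. apply cont_mult; [apply cont_const|apply cont_mult; apply cont_trig].
  - intros x. unfold lin_comb. rewrite Rmult_comm, <- sum_n_m_scale.
    apply sum_n_m_ext. intros m. unfold mode. simpl. ring.
Qed.

(** For fixed [s] the indices [i] with [eigenvalue i = s] belong to different
    Fourier modes, as the two roots of one frequency differ; orthogonality makes
    these modes independent.  They span because the Fourier coefficients of an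
    eigenfunction solve the boundary problem of their frequency, and so vanish
    unless [s] is one of its roots. *)
Lemma eigenspace_dim s : exists l, fibre eigenvalue s l /\
  has_dim (steklov_eigenspace T g s) (length l).
Proof.
  destruct (eigenvalue_proper s) as [N hN].
  set (l := filter (fun i => if Req_EM_T (eigenvalue i) s then true else false) (seq 0 N)).
  assert (hl : forall i, In i l <-> eigenvalue i = s).
  { intros i. unfold l. rewrite filter_In, in_seq.
    destruct (Req_EM_T (eigenvalue i) s) as [h|h]; [|easy].
    split; [easy|]. intros _. split; [|easy]. specialize (hN i ltac:(lra)). lia. }
  assert (nd : NoDup l) by (apply NoDup_filter, seq_NoDup).
  exists l. split; [split; easy|].
  set (js := fun m => Nat.div2 (nth (m - 1) l 0%nat)).
  assert (inl : forall m, (1 <= m <= length l)%nat -> eigenvalue (nth (m - 1) l 0%nat) = s).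
  { intros m hm. apply hl, nth_In. lia. }
  assert (inj : forall m m', (1 <= m <= length l)%nat -> (1 <= m' <= length l)%nat ->
             js m = js m' -> m = m').
  { intros m m' hm hm' e.
    assert (h : nth (m - 1) l 0%nat = nth (m' - 1) l 0%nat).
    { apply eigenvalue_inj; [easy|]. now rewrite !inl. }
    apply (proj1 (NoDup_nth l 0%nat) nd) in h; lia. }
  assert (surj : forall j, charpoly (freq j) s = 0 ->
             exists m, (1 <= m <= length l)%nat /\ js m = j).
  { intros j hj. apply charpoly_zero in hj.
    assert (hi : exists i, In i l /\ Nat.div2 i = j).
    { destruct hj as [hj|hj].
      - exists (2 * j)%nat. split; [|apply Nat.div2_double].
        apply hl. now rewrite eigenvalue_even.
      - exists (S (2 * j)). split; [|apply Nat.div2_succ_double].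
        apply hl. now rewrite eigenvalue_odd. }
    destruct hi as [i [hi <-]]. destruct (In_nth l i 0%nat hi) as [m [hm <-]].
    exists (S m). split; [lia|]. unfold js. now replace (S m - 1)%nat with m by lia. }
  assert (single : forall c e m, (1 <= m <= length l)%nat ->
    cint (fun x => lin_comb (length l) c (fun m => mode s (js m)) e x * trig (js m) x) =
    c m * mode_value (freq (js m)) s e * cint (fun x => trig (js m) x * trig (js m) x)).
  { intros c e m hm. rewrite coef_lin_comb. rewrite (sum_n_m_only _ m); [easy|easy|].
    intros i hi ne. rewrite cint_trig_orthogonal; [ring|].
    intros h. now apply ne, inj. }
  exists (fun m => mode s (js m)). split; [|split].
  - intros m hm. apply mode_in_eigenspace. rewrite <- (inl m hm). apply charpoly_eigenvalue.
  - intros c hc m hm. assert (h := single c Bottom m hm).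
    rewrite (cint_ext _ (fun _ => 0)), cint_const in h by (intros; rewrite hc; ring).
    assert (h1 := cint_trig_sqr_pos (js m)). assert (h2 := dn_off_pos (freq (js m))).
    simpl mode_value in h. rewrite Rmult_0_r in h. symmetry in h.
    apply Rmult_integral in h. destruct h as [h|h]; [|lra].
    apply Rmult_integral in h. destruct h as [h|h]; [easy|lra].
  - intros phi hphi.
    set (A := fun j => cint (fun x => phi Bottom x * trig j x)).
    exists (fun m => A (js m) / (dn_off (freq (js m)) * cint (fun x => trig (js m) x * trig (js m) x))).
    set (c := fun m => _).
    assert (cphi : forall e, cont (phi e)).
    { intros e x. apply (ex_derive_continuous (V := R_NormedModule)).
      apply (proj1 (proj1 hphi e) 1%nat). }
    assert (cmode : forall j e, cont (mode s j e)).
    { intros j e. apply cont_mult; [apply cont_const|apply cont_trig]. }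
    assert (clin : forall e, cont (lin_comb (length l) c (fun m => mode s (js m)) e)).
    { intros e. apply (cont_sum (length l) (fun m x => c m * mode s (js m) e x)).
      intros m. apply cont_mult; [apply cont_const|apply cmode]. }
    intros e x.
    assert (z : 1 * phi e x + -1 * lin_comb (length l) c (fun m => mode s (js m)) e x = 0);
      [|lra].
    revert x. apply fourier_complete.
    + now apply cont_lin.
    + intros x. rewrite (proj2 (proj1 hphi e)). f_equal. f_equal. unfold lin_comb.
      apply sum_n_m_ext. intros m. unfold mode. now rewrite trig_period.
    + intros j.
      rewrite (cint_ext _ (fun x => 1 * (phi e x * trig j x)
        + -1 * (lin_comb (length l) c (fun m => mode s (js m)) e x * trig j x)))
        by (intros; ring).
      rewrite cint_lin by (apply cont_mult; [easy|apply cont_trig]).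
      destruct (eigenfunction_coefficients s phi hphi j) as [q1 q2].
      fold (A j) in q1, q2. set (B := cint (fun x => phi Top x * trig j x)) in *.
      assert (off := dn_off_pos (freq j)). assert (sq := dn_diag_sqr (freq j)).
      assert (hB : B = A j / dn_off (freq j) * (dn_diag (freq j) - s * al)).
      { apply Rmult_eq_reg_l with (dn_off (freq j)); [|lra].
        transitivity (A j * (dn_diag (freq j) - s * al)); [lra|]. field. lra. }
      destruct (excluded_middle_informative (charpoly (freq j) s = 0)) as [root|noroot].
      * destruct (surj j root) as [m [hm <-]]. rewrite single by easy.
        assert (np := cint_trig_sqr_pos (js m)). unfold c.
        destruct e; simpl mode_value.
        -- fold (A (js m)). field. lra.
        -- fold B. rewrite hB. field. lra.
      * assert (Az : A j = 0).
        { assert (h : charpoly (freq j) s * A j = 0).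
          { transitivity ((dn_diag (freq j) - s * be) * ((dn_diag (freq j) - s * al) * A j)
                          - dn_off (freq j) ^ 2 * A j).
            - unfold charpoly. replace (INR (freq j) ^ 2) with (dn_diag (freq j) ^ 2 - dn_off (freq j) ^ 2) by lra. ring.
            - replace ((dn_diag (freq j) - s * al) * A j) with (dn_off (freq j) * B) by lra.
              transitivity (dn_off (freq j) * ((dn_diag (freq j) - s * be) * B - dn_off (freq j) * A j)); [ring|].
              replace ((dn_diag (freq j) - s * be) * B - dn_off (freq j) * A j) with 0 by lra. ring. }
          apply Rmult_integral in h. destruct h; easy. }
        rewrite coef_lin_comb, sum_n_m_null.
        -- destruct e; [fold (A j)|fold B; rewrite hB]; rewrite Az; unfold Rdiv; ring.
        -- intros m hm. rewrite cint_trig_orthogonal; [ring|].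
           intros <-. apply noroot. rewrite <- (inl m hm). apply charpoly_eigenvalue.
Qed.
End Metric.
End Separation.

(** * The upper bound *)

Lemma longest_prefix (P : nat -> Prop) (N : nat) :
  exists m, (m <= N)%nat /\ (forall k, (k < m)%nat -> P k) /\ ((m < N)%nat -> ~ P m).
Proof.
  induction N as [|N [m [h1 [h2 h3]]]].
  - exists 0%nat. repeat split; intros; lia.
  - destruct (excluded_middle_informative (m = N /\ P N)) as [[-> h]|h].
    + exists (S N). split; [lia|]. split; [|lia]. intros k hk.
      destruct (Nat.eq_dec k N) as [->|]; [easy|apply h2; lia].
    + exists m. split; [lia|]. split; [easy|]. intros _ hp.
      destruct (Nat.eq_dec m N) as [->|]; [now apply h|]. apply h3; [lia|easy].
Qed.

Section Upper.
Variables (T al be : R) (n : nat).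
Hypothesis hT : 0 < T.
Hypothesis hal : 0 < al.
Hypothesis hbe : 0 < be.
Hypothesis hn : (1 <= n)%nat.

(** [4 pi n / T20], the normalized eigenvalue of the critical catenoid, divided by
    the boundary length. *)
Definition critical_level : R := 2 * INR n / (T20 * (al + be)).
(** Chosen such that [4 al be = (1 - asymmetry) (al + be)^2]. *)
Definition asymmetry : R := (Rabs (al - be) / (al + be)) ^ 2.
(** The level in the units in which the half height and the mean of [al] and [be]
    are [1]; it is at least [1] when [T] is at least the critical height. *)
Definition scaled_level : R := INR n * T / (2 * T20).

Let M := critical_level.
Let d := asymmetry.
Let w := scaled_level.

Lemma n_pos : 0 < INR n.
Proof. apply lt_0_INR. lia. Qed.

Lemma scaled_level_pos : 0 < w.
Proof.
  assert (h := n_pos). destruct T20_spec as [h' _]. unfold w, scaled_level.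
  apply Rdiv_lt_0_compat; nra.
Qed.

Lemma critical_level_pos : 0 < M.
Proof.
  assert (h := n_pos). destruct T20_spec as [h' _]. unfold M, critical_level.
  apply Rdiv_lt_0_compat; nra.
Qed.

Lemma scaled_charpoly k :
  (T / 2) ^ 2 * charpoly T al be k M =
  w ^ 2 + (INR k * T / 2) ^ 2 - w * ycoth (2 * (INR k * T / 2)) - d * w ^ 2.
Proof.
  destruct T20_spec as [h' _]. unfold charpoly, dn_diag, d, asymmetry, w, scaled_level, M, critical_level.
  replace (2 * (INR k * T / 2)) with (INR k * T) by field.
  replace ((Rabs (al - be) / (al + be)) ^ 2) with ((al - be) ^ 2 / (al + be) ^ 2)
    by (rewrite <- (pow2_abs (al - be)); field; lra).
  field. lra.
Qed.

Lemma charpoly_pos_below k : M < low_root T al be k -> 0 < charpoly T al be k M.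
Proof.
  intros h. rewrite charpoly_factor by easy.
  assert (l := low_lt_high T hT al be hal hbe k).
  apply Rmult_lt_0_compat; [nra|]. apply Rmult_neg_neg; lra.
Qed.

(** Below the smaller root the level is also below the geometric mean of the
    two roots; together with [ycoth (2 z) >= 2 z] this forces [w < z]. *)
Lemma frequency_large k : M < low_root T al be k -> w < INR k * T / 2.
Proof.
  intros h. assert (hp := charpoly_pos_below k h).
  assert (hw := scaled_level_pos). assert (hM := critical_level_pos).
  assert (kp := pos_INR k). set (z := INR k * T / 2).
  assert (hz : 0 <= z) by (unfold z; nra).
  destruct (Rlt_dec w z) as [|nlt]; [easy|exfalso].
  assert (sc := scaled_charpoly k). fold z in sc.
  assert (pos : 0 < (T / 2) ^ 2 * charpoly T al be k M)
    by (apply Rmult_lt_0_compat; [apply pow_lt; lra|easy]).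
  rewrite sc in pos. assert (y := ycoth_ge (2 * z) ltac:(lra)).
  set (r := Rabs (al - be) / (al + be)). assert (hd : d = r ^ 2) by easy.
  assert (r0 : 0 <= r) by (apply Rdiv_le_0_compat; [apply Rabs_pos|lra]).
  assert (r1 : r < 1).
  { apply Rmult_lt_reg_r with (al + be); [lra|]. unfold r.
    replace (Rabs (al - be) / (al + be) * (al + be)) with (Rabs (al - be)) by (field; lra).
    rewrite Rmult_1_l. apply Rabs_def1; lra. }
  assert (geo : (1 - d) * w ^ 2 < z ^ 2).
  { assert (l := low_lt_high T hT al be hal hbe k).
    assert (p := root_product T hT al be hal hbe k).
    assert (q : al * be * M ^ 2 < INR k ^ 2).
    { rewrite <- p. apply Rmult_lt_compat_l; [nra|]. nra. }
    assert (e : (1 - d) * w ^ 2 = (T / 2) ^ 2 * (al * be * M ^ 2)).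
    { destruct T20_spec as [h' _]. unfold d, asymmetry, w, scaled_level, M, critical_level.
      replace ((Rabs (al - be) / (al + be)) ^ 2) with ((al - be) ^ 2 / (al + be) ^ 2)
        by (rewrite <- (pow2_abs (al - be)); field; lra).
      field. lra. }
    rewrite e. replace (z ^ 2) with ((T / 2) ^ 2 * INR k ^ 2) by (unfold z; field).
    apply Rmult_lt_compat_l; [apply pow_lt; lra|easy]. }
  rewrite hd in *.
  assert (w * (2 * z) <= w * ycoth (2 * z)) by (apply Rmult_le_compat_l; lra).
  assert (sq : (r * w) ^ 2 < (w - z) ^ 2) by nra.
  assert (rw : 0 <= r * w) by nra.
  assert (lin : r * w < w - z) by nra.
  assert (z < (1 - r) * w) by lra.
  assert (z ^ 2 <= ((1 - r) * w) ^ 2) by (apply pow_incr; lra).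
  assert ((1 - r) ^ 2 * w ^ 2 <= (1 - r ^ 2) * w ^ 2)
    by (apply Rmult_le_compat_r; [apply pow2_ge_0|nra]).
  rewrite Rpow_mult_distr in H1. lra.
Qed.

(** If the first [m1] frequencies have their smaller root, and the first [m2]
    their larger root, below the critical level, these are [2 m1 - 1] and
    [2 m2 - 1] (or none) Fourier modes; so [m1 + m2 > n] suffices. *)
Lemma many_small_eigenvalues : exists J, NoDup J /\ (2 * n <= length J)%nat /\
  forall i, In i J -> eigenvalue T al be i <= M.
Proof.
  destruct (longest_prefix (fun k => low_root T al be k <= M) (n + 1)) as [m1 [a1 [b1 c1]]].
  destruct (longest_prefix (fun k => high_root T al be k <= M) (n + 1)) as [m2 [a2 [b2 c2]]].
  assert (hM := critical_level_pos). assert (hw := scaled_level_pos).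
  assert (zero_root : low_root T al be 0 = 0).
  { assert (p := root_product T hT al be hal hbe 0). assert (q := high_root_pos T hT al be hal hbe 0).
    simpl in p. rewrite Rmult_0_l in p. apply Rmult_integral in p.
    destruct p as [p|p]; [nra|]. apply Rmult_integral in p. destruct p; lra. }
  assert (m1pos : (1 <= m1)%nat).
  { destruct m1 as [|m1]; [|lia]. exfalso. apply c1; [lia|]. simpl. lra. }
  assert (enough : (n + 1 <= m1 + m2)%nat).
  { destruct (Nat.le_gt_cases (n + 1) (m1 + m2)) as [|few]; [easy|exfalso].
    assert (l1 : M < low_root T al be m1) by (specialize (c1 ltac:(lia)); simpl in c1; lra).
    assert (l2 : M < high_root T al be m2) by (specialize (c2 ltac:(lia)); simpl in c2; lra).
    assert (z1w := frequency_large m1 l1).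
    assert (p1 := charpoly_pos_below m1 l1).
    assert (pos := pos_INR m2). destruct T20_spec as [pa _]. assert (a2' := T20_lt_2).
    assert (sum : INR m1 * T / 2 + INR m2 * T / 2 <= T20 * w).
    { replace (T20 * w) with (INR n * T / 2) by (unfold w, scaled_level; field; lra).
      assert (INR m1 + INR m2 <= INR n) by (rewrite <- plus_INR; apply le_INR; lia). nra. }
    assert (order : (m2 < m1)%nat).
    { apply INR_lt. assert (INR m2 * T / 2 < INR m1 * T / 2) by nra. nra. }
    assert (p2 : charpoly T al be m2 M <= 0).
    { rewrite charpoly_factor by easy. assert (b := b1 m2 order). simpl in b.
      assert (0 < al * be) by nra.
      assert ((M - low_root T al be m2) * (M - high_root T al be m2) <= 0) by nra. nra. }
    assert (q : 0 < (T / 2) ^ 2) by (apply pow_lt; lra).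
    apply (critical_frequencies w (INR m1 * T / 2) (INR m2 * T / 2) d); try easy.
    - apply pow2_ge_0.
    - nra.
    - rewrite <- scaled_charpoly. nra.
    - rewrite <- scaled_charpoly. nra.
    - intros w1. destruct m2 as [|m2]; [simpl; field|exfalso].
      assert (b := b2 0%nat ltac:(lia)). simpl in b.
      assert (p0 : 0 <= charpoly T al be 0 M).
      { rewrite charpoly_factor by easy. rewrite zero_root.
        assert (0 < al * be) by nra. apply Rmult_le_pos; nra. }
      assert (s0 := scaled_charpoly 0). simpl INR in s0.
      replace (0 * T / 2) with 0 in s0 by field. rewrite Rmult_0_r, ycoth_0 in s0.
      assert (d0 : 0 <= d) by apply pow2_ge_0.
      assert (0 <= (T / 2) ^ 2 * charpoly T al be 0 M) by (apply Rmult_le_pos; lra).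
      rewrite s0 in H. assert (0 <= d * w ^ 2) by (apply Rmult_le_pos; [easy|apply pow2_ge_0]). nra. }
  assert (small_freq : forall j m, (j < 2 * m - 1)%nat -> (freq j < m)%nat).
  { intros j m h. destruct (freq_cases j); lia. }
  exists (map (fun j => (2 * j)%nat) (seq 0 (2 * m1 - 1)) ++
          map (fun j => S (2 * j)) (seq 0 (2 * m2 - 1))).
  split; [|split].
  - apply NoDup_app.
    + apply Injective_map_NoDup; [intros x y; lia|apply seq_NoDup].
    + apply Injective_map_NoDup; [intros x y; lia|apply seq_NoDup].
    + intros i h h'. apply in_map_iff in h, h'. destruct h as [j [h _]], h' as [j' [h' _]]. lia.
  - rewrite length_app, !length_map, !length_seq. lia.
  - intros i hi. apply in_app_or in hi. destruct hi as [hi|hi]; apply in_map_iff in hi;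
      destruct hi as [j [<- hj]]; apply in_seq in hj.
    + rewrite eigenvalue_even. apply b1, small_freq. lia.
    + rewrite eigenvalue_odd. apply b2, small_freq. lia.
Qed.
End Upper.

Lemma steklov_bound (n : nat) (T : R) (g : metric) : (1 <= n)%nat ->
  rotationally_symmetric T g ->
  normalized_steklov T g (2 * n - 1) <= 4 * PI * INR n / T20.
Proof.
  intros hn [hT [f [_ [fpos fg]]]].
  assert (hal := fpos 0 ltac:(lra)). assert (hbe := fpos T ltac:(lra)).
  unfold normalized_steklov.
  rewrite (boundary_length_conformal T hT (f 0) (f T) g f fpos fg eq_refl eq_refl).
  destruct (many_small_eigenvalues T (f 0) (f T) n hT hal hbe hn) as [J [nd [len hJ]]].
  assert (up : steklov T g (2 * n - 1) <= critical_level (f 0) (f T) n).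
  { apply (steklov_upper T g (eigenvalue T (f 0) (f T))
             (eigenvalue_proper T hT _ _ hal hbe)
             (eigenspace_dim T hT _ _ hal hbe g f fpos fg eq_refl eq_refl) _ _ J);
      [easy|lia|easy]. }
  assert (ppi := PI_RGT_0). destruct T20_spec as [pa _].
  replace (4 * PI * INR n / T20) with (critical_level (f 0) (f T) n * (2 * PI * (f 0 + f T)))
    by (unfold critical_level; field; lra).
  apply Rmult_le_compat_r; [nra|easy].
Qed.

(** * The critical catenoid *)

Lemma catenoid_conformal (n : nat) (t x : R) : (1 <= n)%nat ->
  let r := INR n * cosh (INR n * t - T20) in
  g_tt (critical_catenoid n) t x = r ^ 2 /\ g_th (critical_catenoid n) t x = 0 /\
  g_hh (critical_catenoid n) t x = r ^ 2.
Proof.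
  intros hn r. assert (np : 0 < INR n) by (apply lt_0_INR; lia).
  set (y := INR n * t - T20).
  assert (ey : INR n * (t - T20 / INR n) = y) by (unfold y; field; lra).
  unfold critical_catenoid, induced_metric. cbn [g_tt g_th g_hh].
  assert (e1 : d_t (fun t => catenoid_X n (t - T20 / INR n)) t x = INR n).
  { apply is_derive_unique. unfold catenoid_X. auto_derive; [easy|ring]. }
  assert (e2 : d_th (fun t => catenoid_X n (t - T20 / INR n)) t x = 0).
  { apply is_derive_unique. unfold catenoid_X. auto_derive; [easy|ring]. }
  assert (e3 : d_t (fun t => catenoid_Y n (t - T20 / INR n)) t x
               = INR n * sinh y * cos (INR n * x)).
  { apply is_derive_unique. unfold catenoid_Y. auto_derive; [easy|].
    rewrite <- ey. unfold Rminus. unfold Rdiv. ring. }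
  assert (e4 : d_th (fun t => catenoid_Y n (t - T20 / INR n)) t x
               = - (INR n * cosh y * sin (INR n * x))).
  { apply is_derive_unique. unfold catenoid_Y. auto_derive; [easy|].
    rewrite <- ey. unfold Rminus. unfold Rdiv. ring. }
  assert (e5 : d_t (fun t => catenoid_Z n (t - T20 / INR n)) t x
               = INR n * sinh y * sin (INR n * x)).
  { apply is_derive_unique. unfold catenoid_Z. auto_derive; [easy|].
    rewrite <- ey. unfold Rminus. unfold Rdiv. ring. }
  assert (e6 : d_th (fun t => catenoid_Z n (t - T20 / INR n)) t x
               = INR n * cosh y * cos (INR n * x)).
  { apply is_derive_unique. unfold catenoid_Z. auto_derive; [easy|].
    rewrite <- ey. unfold Rminus. unfold Rdiv. ring. }
  rewrite e1, e2, e3, e4, e5, e6.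
  assert (sc := sin2_cos2 (INR n * x)). unfold Rsqr in sc.
  assert (cs := cosh_sqr y).
  assert (c2 : sin (INR n * x) ^ 2 = 1 - cos (INR n * x) ^ 2) by lra.
  unfold r. fold y. split; [|split].
  - transitivity (INR n ^ 2 * (1 + sinh y ^ 2 * (sin (INR n * x) ^ 2 + cos (INR n * x) ^ 2))); [ring|].
    rewrite c2. rewrite Rpow_mult_distr, cs. ring.
  - ring.
  - transitivity (INR n ^ 2 * cosh y ^ 2 * (sin (INR n * x) ^ 2 + cos (INR n * x) ^ 2)); [ring|].
    rewrite c2. ring.
Qed.

Lemma critical_height_pos (n : nat) : (1 <= n)%nat -> 0 < critical_height n.
Proof.
  intros hn. assert (0 < INR n) by (apply lt_0_INR; lia). destruct T20_spec as [pa _].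
  unfold critical_height. apply Rdiv_lt_0_compat; lra.
Qed.

Lemma catenoid_factor_pos (n : nat) (t : R) : (1 <= n)%nat ->
  0 < INR n * cosh (INR n * t - T20).
Proof.
  intros hn. assert (0 < INR n) by (apply lt_0_INR; lia).
  apply Rmult_lt_0_compat; [easy|apply cosh_pos].
Qed.

Lemma catenoid_rotationally_symmetric (n : nat) : (1 <= n)%nat ->
  rotationally_symmetric (critical_height n) (critical_catenoid n).
Proof.
  intros hn. split; [now apply critical_height_pos|].
  exists (fun t => INR n * cosh (INR n * t - T20)). split; [|split].
  - exists (fun t => INR n * cosh (INR n * t - T20)). split; [|easy].
    apply smooth_of_second_order with (c := INR n ^ 2)
      (p' := fun t => INR n ^ 2 * sinh (INR n * t - T20)).
    + intros t. auto_derive; [easy|]. unfold Rminus. ring.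
    + intros t. auto_derive; [easy|]. unfold Rminus. ring.
  - intros t _. now apply catenoid_factor_pos.
  - intros t x _. now apply catenoid_conformal.
Qed.

Lemma symmetric_roots (T A : R) (k : nat) : 0 < T -> 0 < A ->
  low_root T A A k = (dn_diag T k - dn_off T k) / A /\
  high_root T A A k = (dn_diag T k + dn_off T k) / A.
Proof.
  intros hT hA.
  assert (s : sqrt (discr T A A k) = 2 * A * dn_off T k).
  { unfold discr. rewrite Rpow_mult_distr, (dn_diag_sqr T hT).
    replace ((dn_off T k ^ 2 + INR k ^ 2) * (A + A) ^ 2 - 4 * (A * A) * INR k ^ 2)
      with ((2 * A * dn_off T k) ^ 2) by ring.
    apply sqrt_pow2. assert (h := dn_off_pos T hT k). nra. }
  unfold low_root, high_root. rewrite s. split; field; lra.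
Qed.

Lemma dn_eigenvalues (T : R) (k : nat) : 0 < T -> k <> 0%nat ->
  dn_diag T k - dn_off T k = INR k / coth (INR k * T / 2) /\
  dn_diag T k + dn_off T k = INR k * coth (INR k * T / 2).
Proof.
  intros hT nz. destruct (freq_height_pos T hT k nz) as [h1 [h2 h3]].
  rewrite dn_diag_pos_freq by easy. unfold dn_off.
  destruct (Nat.eqb_spec k 0); [easy|].
  set (z := INR k * T / 2). assert (hz : 0 < z) by (unfold z; lra).
  replace (INR k * T) with (z + z) by (unfold z; field).
  rewrite sinh_add, cosh_add. unfold coth.
  replace (sinh z * cosh z + cosh z * sinh z) with (2 * (sinh z * cosh z)) by ring.
  assert (sz := sinh_pos z hz). assert (cz := cosh_pos z). assert (e := cosh_sqr z).
  split.
  - transitivity (INR k * (cosh z ^ 2 + sinh z ^ 2 - 1) / (2 * (sinh z * cosh z))); [field; lra|].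
    rewrite e. field. lra.
  - transitivity (INR k * (cosh z ^ 2 + (1 + sinh z ^ 2)) / (2 * (sinh z * cosh z))); [field; lra|].
    rewrite <- e. field. lra.
Qed.

(** With [z = k T / 2] the two eigenvalues of frequency [k] are [z / coth z] and
    [z coth z] in units of the level.  The second is at least [1], and the first
    is below [1] only for [z < T20], that is, for [k < n]. *)
Lemma catenoid_small_eigenvalue (n : nat) (A : R) (i : nat) : (1 <= n)%nat -> 0 < A ->
  eigenvalue (critical_height n) A A i < critical_level A A n ->
  exists j, (j < 2 * n - 1)%nat /\ i = (2 * j)%nat.
Proof.
  intros hn hA lt. assert (hT := critical_height_pos n hn). set (T := critical_height n) in *.
  assert (np : 0 < INR n) by (apply lt_0_INR; lia). destruct T20_spec as [pa ea].
  assert (level : critical_level A A n = 2 / T / A)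
    by (unfold critical_level, T, critical_height; field; lra).
  rewrite level in lt.
  assert (scale : forall q, q / A < 2 / T / A -> q * T / 2 < 1).
  { intros q h. apply (Rmult_lt_compat_r A) in h; [|easy].
    replace (q / A * A) with q in h by (field; lra).
    replace (2 / T / A * A) with (2 / T) in h by (field; lra).
    apply (Rmult_lt_compat_r (T / 2)) in h; [|lra].
    replace (2 / T * (T / 2)) with 1 in h by (field; lra). lra. }
  set (j := Nat.div2 i) in *. exists j.
  destruct (symmetric_roots T A (freq j) hT hA) as [lo hi].
  destruct (index_cases i) as [ei|ei]; fold j in ei; rewrite ei in lt.
  - rewrite eigenvalue_even, lo in lt. apply scale in lt. split; [|easy].
    destruct (Nat.le_gt_cases n (freq j)) as [ge|]; [exfalso|destruct (freq_cases j); lia].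
    rewrite (proj1 (dn_eigenvalues T (freq j) hT ltac:(lia))) in lt.
    set (z := INR (freq j) * T / 2) in *.
    assert (az : T20 <= z).
    { apply le_INR in ge. unfold z, T, critical_height.
      replace (INR (freq j) * (2 * T20 / INR n) / 2) with (INR (freq j) / INR n * T20)
        by (field; lra).
      assert (1 <= INR (freq j) / INR n).
      { apply Rmult_le_reg_r with (INR n); [easy|].
        replace (INR (freq j) / INR n * INR n) with (INR (freq j)) by (field; lra). lra. }
      nra. }
    assert (dec := coth_decreasing T20 z pa az). assert (c1 := coth_gt_1 z ltac:(lra)).
    set (c := coth z) in *. clearbody c.
    replace (INR (freq j) / c * T / 2) with (z / c) in lt by (unfold z; field; lra).
    apply (Rmult_lt_compat_r c) in lt; [|lra].
    replace (z / c * c) with z in lt by (field; lra). lra.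
  - exfalso. rewrite eigenvalue_odd, hi in lt. apply scale in lt.
    destruct (Nat.eq_dec (freq j) 0) as [e|nz].
    + rewrite e, dn_diag_0 in lt by easy. unfold dn_off in lt. simpl in lt.
      replace ((/ T + / T) * T / 2) with 1 in lt by (field; lra). lra.
    + rewrite (proj2 (dn_eigenvalues T (freq j) hT nz)) in lt.
      destruct (freq_height_pos T hT (freq j) nz) as [h1 [h2 h3]].
      assert (y := ycoth_ge_1 (INR (freq j) * T / 2) ltac:(lra)).
      rewrite ycoth_pos in y by lra. lra.
Qed.

Lemma catenoid_value (n : nat) : (1 <= n)%nat ->
  4 * PI * INR n / T20 <=
  normalized_steklov (critical_height n) (critical_catenoid n) (2 * n - 1).
Proof.
  intros hn. assert (hT := critical_height_pos n hn).
  set (f := fun t => INR n * cosh (INR n * t - T20)).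
  assert (fpos : forall t, 0 <= t <= critical_height n -> 0 < f t)
    by (intros; now apply catenoid_factor_pos).
  assert (fg : forall t x, 0 <= t <= critical_height n ->
    g_tt (critical_catenoid n) t x = f t ^ 2 /\ g_th (critical_catenoid n) t x = 0 /\
    g_hh (critical_catenoid n) t x = f t ^ 2) by (intros; now apply catenoid_conformal).
  set (A := INR n * cosh T20).
  assert (np : 0 < INR n) by (apply lt_0_INR; lia). destruct T20_spec as [pa ea].
  assert (hA : 0 < A) by (apply Rmult_lt_0_compat; [easy|apply cosh_pos]).
  assert (f0 : f 0 = A).
  { unfold f, A. rewrite Rmult_0_r, Rminus_0_l, cosh_neg. easy. }
  assert (fT : f (critical_height n) = A).
  { unfold f, A, critical_height. f_equal. f_equal. field. lra. }
  unfold normalized_steklov.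
  rewrite (boundary_length_conformal _ hT A A _ f fpos fg f0 fT).
  assert (low : critical_level A A n <= steklov (critical_height n) (critical_catenoid n) (2 * n - 1)).
  { apply (steklov_lower _ _ (eigenvalue (critical_height n) A A)
             (eigenvalue_proper _ hT _ _ hA hA)
             (eigenspace_dim _ hT _ _ hA hA _ f fpos fg f0 fT)).
    intros J nd hJ.
    assert (incl J (map (fun j => (2 * j)%nat) (seq 0 (2 * n - 1)))).
    { intros i hi. destruct (catenoid_small_eigenvalue n A i hn hA (hJ i hi)) as [j [hj ->]].
      apply in_map_iff. exists j. split; [easy|]. apply in_seq. lia. }
    apply NoDup_incl_length in H; [|easy]. rewrite length_map, length_seq in H. easy. }
  assert (ppi := PI_RGT_0).
  replace (4 * PI * INR n / T20) with (critical_level A A n * (2 * PI * (A + A)))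
    by (unfold critical_level; field; lra).
  apply Rmult_le_compat_r; [nra|easy].
Qed.

Theorem theorem3p1 (n : nat) (hn : (1 <= n)%nat) :
  rotationally_symmetric (critical_height n) (critical_catenoid n) /\
  forall (T : R) (g : metric), rotationally_symmetric T g ->
    normalized_steklov T g (2 * n - 1)
    <= normalized_steklov (critical_height n) (critical_catenoid n) (2 * n - 1).
Proof.
  split; [now apply catenoid_rotationally_symmetric|]. intros T g hg.
  apply Rle_trans with (1 := steklov_bound n T g hn hg). now apply catenoid_value.
Qed.
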